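(* Let $\mathrm{k}$ be a field of characteristic $0$, let $V$ be a finite dimensional vector space over $\mathrm{k}$, and let $A : V \to V$ be a linear mapping whose Jordan decomposition $A = S + N$ into commuting semisimple and nilpotent summands $S$ and $N$, respectively, is known. For $1 \le \ell \le p$ let $F_{q_\ell}$ be the spaces of generating vectors of Jordan chains of length $m_\ell$ of $N|\ker S$ (for $1 \le \ell \le r$) and of $N|\mathrm{im}\, S$ (for $r+1 \le \ell \le p$), and let $U^{q_\ell}$ be the spaces spanned by the vectors in these Jordan chains, all as defined in the context. Then the following hold. (1) For each $1 \le \ell \le p$ the space $F_{q_\ell}$ is $S$-invariant, $U^{q_\ell} = F_{q_\ell} \oplus N F_{q_\ell} \oplus \cdots \oplus N^{m_\ell - 1} F_{q_\ell}$ with every summand $S$-invariant, and $V = \bigoplus_{\ell=1}^{p} U^{q_\ell}$. Consequently the characteristic polynomial of $S$ on $U^{q_\ell}$ is $\chi_{S|F_{q_\ell}}^{m_\ell}$, where $\chi_{S|F_{q_\ell}}$ is the characteristic polynomial of $S$ on $F_{q_\ell}$, and $\chi_S = \prod_{\ell=1}^{p} \chi_{S|F_{q_\ell}}^{m_\ell}$. (2) For each $1 \le \ell \le p$ one can choose a basis $\{u^\ell_j\}_{j=1}^{q_\ell}$ of $F_{q_\ell}$ so that the matrix of $S|F_{q_\ell}$ is the $q_\ell \times q_\ell$ companion matrix $C_{q_\ell}$ associated to the characteristic polynomial $\chi_{S|F_{q_\ell}}$. When $1 \le \ell \le r$ the matrix $C_{q_\ell}$ is $0$, since $S|F_{q_\ell}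 = 0$. (3) With respect to the basis $\{u^\ell_j, N u^\ell_j, \ldots, N^{m_\ell - 1} u^\ell_j\}_{j=1}^{q_\ell}$ of $U^{q_\ell}$, ordered as $u^\ell_1, \ldots, u^\ell_{q_\ell}, N u^\ell_1, \ldots, N u^\ell_{q_\ell}, \ldots, N^{m_\ell-1}u^\ell_1, \ldots, N^{m_\ell-1}u^\ell_{q_\ell}$, the matrix of $A|U^{q_\ell}$ is the $m_\ell q_\ell \times m_\ell q_\ell$ matrix $$D_{m_\ell q_\ell} = \begin{pmatrix} C_{q_\ell} & 0 & \cdots & \cdots & 0 \\ I & C_{q_\ell} & 0 & \cdots & 0 \\ 0 & I & \ddots & & \vdots \\ \vdots & & \ddots & \ddots & 0 \\ 0 & \cdots & 0 & I & C_{q_\ell} \end{pmatrix},$$ with $C_{q_\ell}$ in each of the $m_\ell$ diagonal blocks, the identity matrix $I$ in every block immediately below the diagonal, and zeros elsewhere. (4) With respect to the basis of $V$ obtained by putting together these bases for $\ell = 1, \ldots, p$, the matrix of $A$ is $\mathrm{diag}(D_{m_1 q_1}, \ldots, D_{m_p q_p})$. This matrix is called the uniform normal form of $A$. (5) This normal form can be computed using only operations in the field $\mathrm{k}$.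
   Context: A linear mapping of $V$ into itself is semisimple if every invariant subspace of $V$ has an invariant complementary subspace. Since $S$ and $N$ commute and $S$ is semisimple, $V = \ker S \oplus \mathrm{im}\, S$ and both summands are invariant under $S$, $N$ and $A$; moreover $A|\ker S = N|\ker S$, and $S|\mathrm{im}\, S$ is invertible. Let $N : W \to W$ be a nilpotent linear mapping of a finite dimensional vector space $W$. If $v \in \ker N^{m} \setminus \ker N^{m-1}$ with $m \ge 1$, then $\{v, Nv, \ldots, N^{m-1}v\}$ is a Jordan chain of length $m$ with generating vector $v$. There is a basis of $W$ that is a union of Jordan chains; displayed so that each Jordan chain is a column (with its generating vector at the bottom and arrows giving the action of $N$ pointing up), it realizes the Young diagram of $N$. Choose a basis of $\ker S$ that realizes the Young diagram of $N|\ker S$, which has, say, $r$ columns. For $1 \le \ell \le r$ let $F_{q_\ell}$ be the space spanned by the generating vectors of the Jordan chains of $N|\ker S$ in $\ker S$ of length $m_\ell$. Likewise, for $r+1 \le \ell \le p$ let $F_{q_\ell}$ be the space spanned by the generating vectors of the Jordan chains of $N|\mathrm{im}\, S$ in $\mathrm{im}\, S$ of length $m_\ell$, which occur in the $p-r$ columns of the Young diagram of $N|\mathrm{im}\, S$. Here $q_\ell = \dim F_{q_\ell}$. Let $U^{q_\ell}$ be the space spanned by the vectors in the Jordan chains of length $m_\ell$ in the Young diagram of $N|\ker S$ when $1 \le \ell \le r$, and in the Young diagram of $N|\mathrm{im}\, S$ when $r+1 \le \ell \le p$. The companion matrix associated to the polynomial $a_0 + a_1\lambda + \cdots + a_{q-1}\lambda^{q-1}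 + \lambda^q$ is the $q \times q$ matrix with entries $1$ immediately below the diagonal, last column $(-a_0, -a_1, \ldots, -a_{q-1})^T$, and all other entries $0$.
   Formalization: S-invariance of the F spaces holds for suitable Jordan chains, not all: some choice has it, and the S-dependent claims are proved for every such choice. As S|F may not be cyclic (S = id), (2)-(5) use F split into S-invariant cyclic summands by invariant factors; on ker S these are lines. *)

(* Defs.v *)
From HB Require Import structures.
From mathcomp Require Import all_boot all_order all_algebra.

Set Implicit Arguments.
Unset Strict Implicit.
Unset Printing Implicit Defensive.

Import GRing.Theory.
Local Open Scope ring_scope.

Section LinearMaps.
Variables (k : fieldType) (V : vectType k).
Implicit Types (f S N A : 'End(V)) (W : {vspace V}).

Definition stable f W := (f @: W <= W)%VS.

Definition semisimple f :=
  forall W, stable f W ->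
  exists W', [/\ stable f W', (W + W' = fullv)%VS & (W :&: W' = 0)%VS].

Definition nilpotent f := exists n, forall v, iter n f v = 0.

Definition jordan_decomposition A S N :=
  [/\ A = S + N, (S \o N)%VF = (N \o S)%VF, semisimple S & nilpotent N].

(* Column convention: column j holds the coordinates of f e_j.  (The library's
   mxof e e f is the transpose.)  It is meaningful when e is free and its span
   is f-invariant. *)
Definition matrix_of n (e : n.-tuple V) f : 'M[k]_n :=
  \matrix_(i, j) coord e i (f (tnth e j)).

(* Characteristic polynomial of f|W, for an f-invariant W. *)
Definition char_poly_on f W : {poly k} := char_poly (matrix_of (vbasis W) f).

(* v generates the Jordan chain v, N v, ..., N^(m-1) v of length m. *)
Definition jordan_chain N m (v : V) :=
  [/\ (0 < m)%N, iter m N v = 0 & iter m.-1 N v != 0].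

(* Generating vectors of Jordan chains, in groups l < ngroups; the nvec l
   vectors gen l of group l all generate chains of length len l.  The first
   nker groups are those of N|ker S, the others those of N|im S. *)
Record generators := Generators {
  ngroups : nat;
  nker : nat;
  len : 'I_ngroups -> nat;
  nvec : 'I_ngroups -> nat;
  gen : forall l, (nvec l).-tuple V }.

Definition gen_space (G : generators) (l : 'I_(ngroups G)) : {vspace V} :=
  <<gen l>>%VS.

(* In block order: u_1, ..., u_q, N u_1, ..., N u_q, ..., N^(m-1) u_q.
   tagnat.sig1 s and tagnat.sig2 s are the block number of s and the position
   of s in that block. *)
Definition chain_tuple N (G : generators) (l : 'I_(ngroups G)) :
    (\sum_(i < len l) nvec l).-tuple V :=
  [tuple iter (tagnat.sig1 s) N (tnth (gen l) (tagnat.sig2 s))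
    | s < (\sum_(i < len l) nvec l)%N].

Definition chain_space N (G : generators) (l : 'I_(ngroups G)) : {vspace V} :=
  <<chain_tuple N l>>%VS.

Definition all_chains N (G : generators) :
    (\sum_l \sum_(i < len l) nvec (g := G) l).-tuple V :=
  [tuple tnth (chain_tuple N (tagnat.sig1 s)) (tagnat.sig2 s)
    | s < (\sum_l \sum_(i < len l) nvec (g := G) l)%N].

Definition chains_where N (G : generators) (P : pred 'I_(ngroups G)) : seq V :=
  flatten [seq (chain_tuple N l : seq V) | l <- enum 'I_(ngroups G) & P l].

(* The chains form bases of ker S and of im S that are unions of Jordan chains
   of N. *)
Definition jordan_bases S N (G : generators) :=
  [/\ (nker G <= ngroups G)%N,
      forall l : 'I_(ngroups G), (0 < nvec l)%N,
      forall (l : 'I_(ngroups G)) (j : 'I_(nvec l)),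
        jordan_chain N (len l) (tnth (gen l) j),
      basis_of (lker S)
        (chains_where N (fun l : 'I_(ngroups G) => (l < nker G)%N)) &
      basis_of (limg S)
        (chains_where N (fun l : 'I_(ngroups G) => ~~ (l < nker G)%N))].

(* The same, where each group consists of all the chains of its length in the
   diagram of N|ker S, respectively of N|im S. *)
Definition young_bases S N (G : generators) :=
  jordan_bases S N G /\
  forall l l' : 'I_(ngroups G),
    (l < nker G)%N = (l' < nker G)%N -> len l = len l' -> l = l'.

(* S|F_l need not be cyclic (for instance, S = id and N = 0 give F_1 = V, on
   which S is not a companion matrix if dim V > 1), so H splits each space F_l
   of G into S-invariant summands, one for each index in the fibre of pi over l.
   The divisibility clause makes their characteristic polynomials the invariant
   factors of S|F_l; so F_l is not split when S|F_l is cyclic, and it is split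
   into lines, one for each column of the Young diagram, when S|F_l = 0. *)
Definition refines S N (G H : generators)
    (pi : 'I_(ngroups H) -> 'I_(ngroups G)) :=
  [/\ jordan_bases S N H,
      forall i, len i = len (pi i) /\ (i < nker H)%N = (pi i < nker G)%N,
      forall i i' : 'I_(ngroups H), (i <= i')%N -> (pi i <= pi i')%N,
      forall l, directv (\sum_(i | pi i == l) gen_space i) /\
                (\sum_(i | pi i == l) gen_space i)%VS = gen_space l &
      (forall i : 'I_(ngroups H), stable S (gen_space i)) /\
      (forall i i' : 'I_(ngroups H), (i <= i')%N -> pi i = pi i' ->
         char_poly_on S (gen_space i') %| char_poly_on S (gen_space i))].

End LinearMaps.

(* The companion matrix of a_0 + ... + a_(q-1) X^(q-1) + X^q, with last column
   - a_0, ..., - a_(q-1); the library's companionmx is its transpose. *)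
Definition companion (k : fieldType) (q : nat) (a : {poly k}) : 'M[k]_q :=
  \matrix_(i, j) (if j.+1 == q then - a`_i else (i == j.+1 :> nat)%:R).

Definition companion_on (k : fieldType) (V : vectType k) (S : 'End(V))
    (G : generators V) (l : 'I_(ngroups G)) : 'M[k]_(nvec l) :=
  companion (nvec l) (char_poly_on S (gen_space l)).

(* gen i is a basis of its span in which S is a companion matrix. *)
Definition companion_bases (k : fieldType) (V : vectType k) (S : 'End(V))
    (G : generators V) :=
  forall i : 'I_(ngroups G), basis_of (gen_space i) (gen i) /\
    matrix_of (gen i) S = companion_on S i.

Definition Dblock (k : fieldType) (m q : nat) (C : 'M[k]_q) :
    'M[k]_(\sum_(i < m) q) :=
  \mxblock_(i < m, j < m)
    (if i == j then C else if i == j.+1 :> nat then 1%:M else 0).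

Definition normal_form (k : fieldType) (V : vectType k) (S : 'End(V))
    (G : generators V) : 'M[k]_(\sum_l \sum_(i < len l) nvec (g := G) l) :=
  \mxdiag_l Dblock (len l) (companion_on S l).

(* D is the uniform normal form obtained from some admissible choices; the
   equation E only identifies the two expressions of the dimension of V. *)
Definition uniform_normal_form (k : fieldType) (V : vectType k)
    (S N : 'End(V)) (n : nat) (D : 'M[k]_n) :=
  exists (G H : generators V) (pi : 'I_(ngroups H) -> 'I_(ngroups G))
         (E : (\sum_l \sum_(i < len l) nvec (g := H) l)%N = n),
    [/\ young_bases S N G,
        forall l : 'I_(ngroups G), stable S (gen_space l),
        refines S N pi, companion_bases S H &
        D = castmx (E, E) (normal_form S H)].

(* Rational expressions over the prime field in variables indexed by I. *)
Inductive field_expr (I : Type) : Type :=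
  | FVar of I
  | FZero
  | FOne
  | FAdd of field_expr I & field_expr I
  | FOpp of field_expr I
  | FMul of field_expr I & field_expr I
  | FInv of field_expr I.
Arguments FZero {I}.
Arguments FOne {I}.

Fixpoint feval (k : fieldType) (I : Type) (env : I -> k) (e : field_expr I) : k :=
  match e with
  | FVar i => env i
  | FZero => 0
  | FOne => 1
  | FAdd a b => feval env a + feval env b
  | FOpp a => - feval env a
  | FMul a b => feval env a * feval env b
  | FInv a => (feval env a)^-1
  end.

(* Algebraic computation trees: a computation evaluates expressions built with
   the field operations, branches on whether such an expression is zero, and
   stops after finitely many steps with an output of type X. *)
Inductive field_tree (I X : Type) : Type :=
  | Return of X
  | IfZero of field_expr I & field_tree I X & field_tree I X.

Fixpoint run (k : fieldType) (I X : Type) (env : I -> k) (t : field_tree I X) : X :=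
  match t with
  | Return x => x
  | IfZero e t0 t1 => if feval env e == 0 then run env t0 else run env t1
  end.

(* A computation whose input is a pair of n x n matrices and whose output is an
   n x n matrix. *)
Definition matrix_algorithm (n : nat) : Type :=
  field_tree ('I_n * 'I_n + 'I_n * 'I_n)
    'M[field_expr ('I_n * 'I_n + 'I_n * 'I_n)]_n.

Definition run_algorithm (k : fieldType) (n : nat) (t : matrix_algorithm n)
    (X Y : 'M[k]_n) : 'M[k]_n :=
  let env s := match s with inl ij => X ij.1 ij.2 | inr ij => Y ij.1 ij.2 end in
  map_mx (feval env) (run env t).

(* Main.v *)
Require Import Defs.
From HB Require Import structures.
From Stdlib Require Import Classical FunctionalExtensionality IndefiniteDescription.
From mathcomp Require Import all_boot all_order perm all_algebra zify.
Import GRing.Theory.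
Local Open Scope ring_scope.

Set Implicit Arguments.
Unset Strict Implicit.
Unset Printing Implicit Defensive.

(** Semisimplicity of S is used in one way only: every S-stable subspace has an
    S-stable complement, also inside a given S-stable subspace.  In particular V is
    the direct sum of ker S and im S.  On each of these, K say, the Young diagram of N
    is built by recursion on N K ([young_decomposition_exists]): the chains of N K are
    prolonged by preimages of their generating vectors, and the kernel of N in N K is
    completed in the kernel of N in K.  The choices are made by stable complements, so
    the spaces of generating vectors are S-stable.  That the resulting families are
    bases is a matter of counting ([jordan_bases_count]).  The characteristic
    polynomials follow because N^i commutes with S and is injective on the generating
    spaces of chains that are longer than i.

    On a space F of generating vectors S is again semisimple.  A vector whose
    annihilator has maximal degree spans a cyclic space, in which S has a companion
    matrix, and the annihilators in a stable complement divide the first one; by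
    recursion F is a sum of cyclic spaces that belong to the invariant factors
    ([cyclic_decomposition_exists], [refining_data_refines]).  In a basis of chains
    over Krylov bases, S acts by companion blocks inside each row of the diagram and N
    shifts the rows, which gives the matrix of A ([refined_normal_form]).

    The algorithm works by guessing and testing. A candidate consists of the numbers
    that describe the shape of the normal form and, for each group of chains, of a
    cyclic generator v and of the coefficients of its annihilator p. That a
    candidate gives a normal form is expressed by rational equations and inequations
    ([valid], [valid_normal_form]), so it is enough to find finitely many candidates
    that are rational in the entries of S and N and one of which is right for every
    input. There are finitely many shapes. For a given shape the groups are treated
    one after the other, those of im S by decreasing length of their chains. The
    polynomial p of the next group is X in ker S; in im S it is the only monic
    polynomial of its degree such that p(S) N^(m-1) maps im S into the span of the
    earlier chains, where m is the length of its chains; this is a linear system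
    ([next_coefficients]). Linear systems are solved by generalized inverses, which
    pivoting makes rational up to finitely many cases ([guess_ginverse]). The
    generator v satisfies N^m v = 0, p(S) v = 0, and S v = 0 in ker S; besides, it
    only has to avoid the zeros of a determinant. In characteristic 0 a polynomial
    of degree at most n has a nonroot among the integers 0, ..., n, so one of
    finitely many integral combinations of solutions that span the solution space
    will do ([next_generator]). *)

(** * Matrices and characteristic polynomials of endomorphisms *)

Section MatrixOf.
Variables (k : fieldType) (V : vectType k).
Implicit Types (f g : 'End(V)) (U W : {vspace V}).

Lemma stableP f W : reflect (forall v, v \in W -> f v \in W) (f @: W <= W)%VS.
Proof.
apply: (iffP subvP) => [h v vW|h _ /memv_imgP[v vW ->]]; last exact: h.
exact/h/memv_img.
Qed.

Lemma matrix_ofP n (e : n.-tuple V) f (M : 'M_n) : free e ->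
  (forall j, f (tnth e j) = \sum_i M i j *: tnth e i) -> matrix_of e f = M.
Proof.
move=> fe h; apply/matrixP => i j; rewrite mxE h.
under eq_bigr do rewrite (tnth_nth 0).
by rewrite coord_sum_free.
Qed.

Lemma matrix_of_sum n (e : n.-tuple V) f W j : basis_of W e -> stable f W ->
  f (tnth e j) = \sum_i matrix_of e f i j *: tnth e i.
Proof.
move=> be /stableP st; have /(coord_basis be) {1}-> : f (tnth e j) \in W.
  by apply: st; exact: basis_mem be (mem_tnth _ _).
by apply: eq_bigr => i _; rewrite mxE -tnth_nth.
Qed.

Lemma coord_apply n (e : n.-tuple V) f W v i : basis_of W e -> stable f W ->
  v \in W -> coord e i (f v) = \sum_j matrix_of e f i j * coord e j v.
Proof.
move=> be st vW; rewrite {1}(coord_basis be vW) linear_sum /= linear_sum /=.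
apply: eq_bigr => j _; rewrite !linearZ /= mulrC; congr (_ * _).
by rewrite mxE (tnth_nth 0).
Qed.

Definition coordmx n (b e : n.-tuple V) : 'M[k]_n :=
  \matrix_(i, j) coord b i (tnth e j).

Lemma coordmxK n (b e : n.-tuple V) W : basis_of W b -> basis_of W e ->
  coordmx b e *m coordmx e b = 1%:M.
Proof.
move=> bb be; apply/matrixP => i j; rewrite !mxE.
have jW : tnth b j \in W by exact: basis_mem bb (mem_tnth _ _).
transitivity (coord b i (\sum_l coord e l (tnth b j) *: e`_l)).
  rewrite linear_sum; apply: eq_bigr => l _.
  by rewrite !mxE linearZ /= mulrC -tnth_nth.
rewrite -(coord_basis be) // (tnth_nth 0) coord_free ?(basis_free bb) //.
by rewrite eq_sym.
Qed.

Lemma coordmx_conj n (b e : n.-tuple V) W f :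
  basis_of W b -> basis_of W e -> stable f W ->
  matrix_of b f *m coordmx b e = coordmx b e *m matrix_of e f.
Proof.
move=> bb be st; apply/matrixP => i j; rewrite !mxE.
have jW : tnth e j \in W by exact: basis_mem be (mem_tnth _ _).
transitivity (coord b i (f (tnth e j))).
  by rewrite (coord_apply _ bb st jW); apply: eq_bigr => l _; rewrite !mxE.
rewrite (matrix_of_sum _ be st) linear_sum; apply: eq_bigr => l _ /=.
by rewrite linearZ /= !mxE mulrC.
Qed.

Lemma char_poly_conj n (A B P Q : 'M[k]_n) : P *m Q = 1%:M ->
  A *m P = P *m B -> char_poly A = char_poly B.
Proof.
move=> PQ APB; pose P' := map_mx polyC P; pose Q' := map_mx polyC Q.
have PQ' : P' *m Q' = 1%:M by rewrite -map_mxM PQ map_mx1.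
have : char_poly_mx A *m P' = P' *m char_poly_mx B.
  rewrite /char_poly_mx mulmxBl mulmxBr scalar_mxC -!map_mxM APB.
  by [].
have dPQ : \det P' * \det Q' = 1 by rewrite -det_mulmx PQ' det1.
move/(congr1 determinant); rewrite !det_mulmx mulrC => E.
by rewrite /char_poly -[LHS]mul1r -dPQ mulrAC E mulrAC dPQ mul1r.
Qed.

Lemma char_poly_basis n (b : n.-tuple V) W f :
  basis_of W b -> stable f W -> char_poly (matrix_of b f) = char_poly_on f W.
Proof.
move=> bb st; have E := size_basis bb; case: n / E b bb => b bb.
rewrite /char_poly_on.
apply: (char_poly_conj (coordmxK bb (vbasisP W))).
exact: coordmx_conj (vbasisP W) st.
Qed.

Lemma char_poly_on0 f : char_poly_on f 0%VS = 1.
Proof.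
rewrite -(@char_poly_basis 0 [tuple] 0%VS) ?nil_basis //.
  by rewrite /char_poly det_mx00.
by rewrite /stable limg0 subvv.
Qed.

Lemma char_poly_on_add f U W : stable f U -> stable f W -> (U :&: W = 0)%VS ->
  char_poly_on f (U + W) = char_poly_on f U * char_poly_on f W.
Proof.
move=> sU sW UW0.
have bUW : basis_of (U + W)%VS [tuple of vbasis U ++ vbasis W].
  by apply: cat_basis; [exact/directv_addP | exact: vbasisP | exact: vbasisP].
have sUW : stable f (U + W) by rewrite /stable limgD addvS.
rewrite -(char_poly_basis bUW sUW) /char_poly_on.
set A := matrix_of (vbasis U) f; set B := matrix_of (vbasis W) f.
rewrite (_ : matrix_of _ f = block_mx A 0 0 B).
  by rewrite /char_poly char_block_diag_mx det_ublock.
apply: matrix_ofP; first exact: basis_free bUW.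
have tl i : tnth [tuple of vbasis U ++ vbasis W] (lshift _ i) = tnth (vbasis U) i.
  by rewrite tnth_lshift.
have tr i : tnth [tuple of vbasis U ++ vbasis W] (rshift _ i) = tnth (vbasis W) i.
  by rewrite tnth_rshift.
move=> j; rewrite big_split_ord /=; case: (split_ordP j) => {}j ->.
  rewrite [X in _ + X]big1 ?addr0 => [|i _]; last first.
    by rewrite block_mxEdl mxE scale0r.
  rewrite tl (matrix_of_sum _ (vbasisP U) sU); apply: eq_bigr => i _.
  by rewrite block_mxEul tl.
rewrite [X in X + _]big1 ?add0r => [|i _]; last first.
  by rewrite block_mxEur mxE scale0r.
rewrite tr (matrix_of_sum _ (vbasisP W) sW); apply: eq_bigr => i _.
by rewrite block_mxEdr tr.
Qed.

Lemma stable_sum (I : Type) (r : seq I) (P : pred I) (Us : I -> {vspace V}) f :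
  (forall i, P i -> stable f (Us i)) -> stable f (\sum_(i <- r | P i) Us i)%VS.
Proof.
move=> st; apply: (big_ind (fun W => stable f W)) => //.
  by rewrite /stable limg0 subvv.
by move=> U W sU sW; rewrite /stable limgD addvS.
Qed.

(** The inequality between dimensions says that the sum is direct; in this form it
    passes to the partial sums. *)
Lemma char_poly_on_sum n (Us : 'I_n -> {vspace V}) f :
  (forall i, stable f (Us i)) -> (\sum_i \dim (Us i) <= \dim (\sum_i Us i))%N ->
  char_poly_on f (\sum_i Us i)%VS = \prod_i char_poly_on f (Us i).
Proof.
elim: n Us => [|n IHn] Us st; first by rewrite !big_ord0 char_poly_on0.
rewrite !big_ord_recr /=; set A := (\sum_i _)%VS => dims.
have dA : (\dim A <= \sum_(i < n) \dim (Us (widen_ord (leqnSn n) i)))%N.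
  exact: dimv_leq_sum.
have := dimv_sum_cap A (Us ord_max) => E.
rewrite char_poly_on_add ?IHn //.
- rewrite -(leq_add2r (\dim (Us ord_max))) (leq_trans dims) //.
  by rewrite -E leq_addr.
- exact: stable_sum.
apply/eqP; rewrite -dimv_eq0 -leqn0 -(leq_add2l (\dim (A + Us ord_max))) E addn0.
by apply: leq_trans dims; rewrite leq_add2r.
Qed.

Lemma char_poly_on_limg f g W : stable f W -> (forall v, f (g v) = g (f v)) ->
  (W :&: lker g = 0)%VS -> char_poly_on f (g @: W) = char_poly_on f W.
Proof.
move=> st fg W0; pose b := map_tuple g (vbasis W).
have bb : basis_of (g @: W)%VS b by apply: limg_basis_of; rewrite ?vbasisP.
have st' : stable f (g @: W)%VS.
  apply/stableP => _ /memv_imgP[v vW ->]; rewrite fg memv_img //.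
  by move/stableP: st; apply.
rewrite -(char_poly_basis bb st') /char_poly_on; congr char_poly.
apply: matrix_ofP (basis_free bb) _ => j.
rewrite tnth_map fg (matrix_of_sum _ (vbasisP W) st) linear_sum.
by apply: eq_bigr => i _; rewrite linearZ tnth_map.
Qed.

End MatrixOf.

(** * Chains and their spans *)

Section Iterates.
Variables (k : fieldType) (U : lmodType k).

(** A name for the iterate as a function of the vector, to carry its linearity. *)
Definition iterl (f : U -> U) i v := iter i f v.

Lemma iterl_linear (f : {linear U -> U}) i : linear (iterl f i).
Proof. by rewrite /iterl; elim: i => [|i IH] a u v //=; rewrite IH linearP. Qed.

HB.instance Definition _ (f : {linear U -> U}) i :=
  GRing.isLinear.Build k U U *:%R (iterl f i) (@iterl_linear f i).

Lemma iter_commute (f g : U -> U) i v : (forall v, f (g v) = g (f v)) ->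
  f (iter i g v) = iter i g (f v).
Proof. by move=> fg; elim: i => //= i IH; rewrite fg IH. Qed.

Lemma iter_linear0 (f : {linear U -> U}) i : iter i f 0 = 0.
Proof. exact: (linear0 (iterl f i)). Qed.

Lemma iter_linearD (f : {linear U -> U}) i u v :
  iter i f (u + v) = iter i f u + iter i f v.
Proof. exact: (linearD (iterl f i)). Qed.

Lemma iter_linearZ (f : {linear U -> U}) i a u : iter i f (a *: u) = a *: iter i f u.
Proof. exact: (linearZ_LR (iterl f i)). Qed.

Lemma iter_linear_sum (f : {linear U -> U}) i (J : Type) (r : seq J) (P : pred J) F :
  iter i f (\sum_(j <- r | P j) F j) = \sum_(j <- r | P j) iter i f (F j).
Proof. exact: (linear_sum (iterl f i)). Qed.

End Iterates.

Section Flatten.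
Variables (k : fieldType) (V : vectType k).

(** The families of chains are indexed by block ranks, but freeness and spans do not
    depend on the order, and lists compose better; hence the permutations. *)
Lemma perm_sig_tuple n (p : 'I_n -> nat) (c : forall l, (p l).-tuple V) :
  perm_eq [tuple tnth (c (tagnat.sig1 s)) (tagnat.sig2 s) | s < (\sum_l p l)%N]
    (flatten [seq (c l : seq V) | l <- enum 'I_n]).
Proof.
apply/seq.permP => a; rewrite count_flatten -map_comp sumnE big_map big_enum /=.
rewrite count_map -sum1_count big_mkcond big_enum /=.
transitivity (\sum_(l < n) \sum_(j < p l) a (tnth (c l) j))%N; last first.
  apply: eq_bigr => l _; rewrite -sum1_count big_tuple [in RHS]big_mkcond /=.
  by [].
rewrite sig_big_dep /= (reindex _ tagnat.sig_bij_on) /=.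
by apply: eq_bigr => s _; rewrite -/(tagnat.sig1 s) -/(tagnat.sig2 s); case: (a _).
Qed.

Lemma span_flatten (ss : seq (seq V)) :
  <<flatten ss>>%VS = (\sum_(s <- ss) <<s>>)%VS.
Proof.
by elim: ss => [|s ss IH] /=; rewrite ?span_nil ?big_nil // span_cat big_cons IH.
Qed.

Lemma eq_mem_span (X Y : seq V) : perm_eq X Y -> <<X>>%VS = <<Y>>%VS.
Proof. by move/perm_mem/eq_span. Qed.

Lemma iter_limgE (N : 'End(V)) i U :
  iter i (lfun_img N) U = (linfun (iterl N i) @: U)%VS.
Proof.
elim: i => [|i IH] /=.
  by rewrite -[LHS]lim1g; apply: eq_in_limg => v _; rewrite !lfunE.
rewrite IH -limg_comp; apply: eq_in_limg => v _.
by rewrite comp_lfunE !lfunE.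
Qed.

Lemma iter_limg_span (N : 'End(V)) i X :
  iter i (lfun_img N) <<X>>%VS = <<[seq iter i N v | v <- X]>>%VS.
Proof.
by rewrite iter_limgE limg_span; congr <<_>>%VS; apply: eq_map => v; rewrite lfunE.
Qed.

Lemma memv_iter_limgP (N : 'End(V)) i (U : {vspace V}) w :
  reflect (exists2 u, u \in U & w = iter i N u) (w \in iter i (lfun_img N) U).
Proof.
rewrite iter_limgE; apply: (iffP memv_imgP) => -[u uU ->]; exists u => //.
  by rewrite lfunE.
by rewrite lfunE.
Qed.

End Flatten.

Section Chains.
Variables (k : fieldType) (V : vectType k).
Implicit Types (A S N : 'End(V)) (G : generators V).

Lemma perm_chain_tuple N G (l : 'I_(ngroups G)) :
  perm_eq (chain_tuple N l)
    (flatten [seq [seq iter i N v | v <- gen l] | i : 'I_(len l) <- enum 'I_(len l)]).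
Proof.
pose c (i : 'I_(len l)) := map_tuple (iter i N) (gen l).
have -> : chain_tuple N l = [tuple
      tnth (c (tagnat.sig1 s)) (tagnat.sig2 s) | s < (\sum_(i < len l) nvec l)%N].
  by apply: eq_from_tnth => s; rewrite !tnth_mktuple tnth_map.
exact: (perm_sig_tuple c).
Qed.

Lemma chain_spaceE N G (l : 'I_(ngroups G)) :
  chain_space N l = (\sum_(i < len l) iter i (lfun_img N) (gen_space l))%VS.
Proof.
rewrite /chain_space (eq_mem_span (perm_chain_tuple N l)) span_flatten big_map.
by rewrite big_enum /=; apply: eq_bigr => i _; rewrite /gen_space iter_limg_span.
Qed.

Lemma perm_all_chains N G :
  perm_eq (all_chains N G) (chains_where N (predT : pred 'I_(ngroups G))).
Proof.
rewrite /chains_where filter_predT; exact: perm_sig_tuple.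
Qed.

Lemma perm_chainsC N G (P : pred 'I_(ngroups G)) :
  perm_eq (chains_where N P ++ chains_where N (fun l => ~~ P l))
    (chains_where N (predT : pred 'I_(ngroups G))).
Proof.
rewrite /chains_where -flatten_cat -map_cat filter_predT.
apply: perm_flatten; apply: perm_map; apply/permPl; exact: (perm_filterC P).
Qed.

Lemma span_chains_where N G (P : pred 'I_(ngroups G)) :
  <<chains_where N P>>%VS = (\sum_(l | P l) chain_space N l)%VS.
Proof. by rewrite span_flatten big_map big_filter big_enum_cond. Qed.

Lemma size_chains_where N G (P : pred 'I_(ngroups G)) :
  size (chains_where N P) = (\sum_(l | P l) len l * nvec l)%N.
Proof.
rewrite size_flatten /shape -map_comp sumnE big_map big_filter big_enum_cond /=.
by apply: eq_bigr => l _; rewrite size_tuple card_ord big_const_ord iter_addn_0 mulnC.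
Qed.

Lemma span_all_chains N G :
  <<all_chains N G>>%VS = (\sum_l chain_space N (G := G) l)%VS.
Proof. by rewrite (eq_mem_span (perm_all_chains N G)) span_chains_where. Qed.

Lemma free_flatten (ss : seq (seq V)) s : s \in ss -> free (flatten ss) -> free s.
Proof.
by case/splitPr => s1 s2; rewrite flatten_cat /= => /catr_free /catl_free.
Qed.

Section FreeChains.
Variables (N : 'End(V)) (G : generators V).
Hypothesis fG : free (all_chains N G).

Lemma chain_tuple_free (l : 'I_(ngroups G)) : free (chain_tuple N l).
Proof.
move: fG; rewrite (perm_free (perm_all_chains N G)) /chains_where filter_predT.
by apply: free_flatten; apply: map_f; rewrite mem_enum.
Qed.

Lemma iter_gen_free (l : 'I_(ngroups G)) i : (i < len l)%N ->
  free [seq iter i N v | v <- gen l].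
Proof.
move=> il; have := chain_tuple_free l; rewrite (perm_free (perm_chain_tuple N l)).
apply: free_flatten; apply/mapP; exists (Ordinal il) => //.
by rewrite mem_enum.
Qed.

Lemma gen_free (l : 'I_(ngroups G)) : (0 < len l)%N -> free (gen l).
Proof. by move=> /iter_gen_free; rewrite map_id. Qed.

Lemma dim_iter_gen_space (l : 'I_(ngroups G)) i : (i < len l)%N ->
  \dim (iter i (lfun_img N) (gen_space l)) = nvec l.
Proof.
move=> il; rewrite /gen_space iter_limg_span.
by have /eqP -> := iter_gen_free il; rewrite size_map size_tuple.
Qed.

Lemma dim_chain_space (l : 'I_(ngroups G)) :
  \dim (chain_space N l) = (\sum_(i < len l) nvec l)%N.
Proof. by have /eqP := chain_tuple_free l; rewrite size_tuple. Qed.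

Lemma chain_space_direct (l : 'I_(ngroups G)) :
  directv (\sum_(i < len l) iter i (lfun_img N) (gen_space l)).
Proof.
rewrite directvE /= -chain_spaceE dim_chain_space; apply/eqP.
by apply: eq_bigr => i _; rewrite dim_iter_gen_space.
Qed.

Lemma sum_chain_space_direct : directv (\sum_l chain_space N (G := G) l).
Proof.
rewrite directvE /= -span_all_chains; have /eqP -> := fG.
by rewrite size_tuple; apply/eqP; apply: eq_bigr => l _; rewrite dim_chain_space.
Qed.

End FreeChains.

(** A stable complement W of ker S contains S W, which is im S, and has the same
    dimension. *)
Lemma semisimple_ker_limg S : semisimple S ->
  (lker S :&: limg S = 0)%VS /\ (lker S + limg S = fullv)%VS.
Proof.
move=> ss; have [|W [sW fW dW]] := ss (lker S).
  by apply/stableP => v; rewrite !memv_ker => /eqP ->; rewrite linear0.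
suff -> : limg S = W by [].
apply/eqP; rewrite eqEdim; apply/andP; split.
  rewrite -fW limgD; have -> : (S @: lker S)%VS = 0%VS by apply/eqP; rewrite -lkerE.
  by rewrite add0v.
rewrite -(leq_add2l (\dim (lker S))) -(dimv_disjoint_sum dW) fW.
by rewrite -{1}(limg_ker_dim S fullv) capfv.
Qed.

Lemma jordan_full S N G : semisimple S -> jordan_bases S N G ->
  basis_of fullv (all_chains N G).
Proof.
move=> ss [_ _ _ bk bi]; have [dKI fKI] := semisimple_ker_limg ss.
rewrite (perm_basis _ (perm_all_chains N G)).
rewrite -(perm_basis _ (perm_chainsC N (fun l : 'I_(ngroups G) => (l < nker G)%N))).
by rewrite -fKI; apply: cat_basis bk bi; apply/directv_addP.
Qed.

Lemma jordan_len0 S N G (l : 'I_(ngroups G)) : jordan_bases S N G -> (0 < len l)%N.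
Proof.
move=> [_ nv jc _ _]; by have [] := jc l (Ordinal (nv l)).
Qed.

Lemma gen_iter_len S N G (l : 'I_(ngroups G)) v :
  jordan_bases S N G -> v \in gen_space l -> iter (len l) N v = 0.
Proof.
move=> [_ nv jc _ _] /coord_span ->; rewrite iter_linear_sum big1 // => i _.
by rewrite iter_linearZ -tnth_nth; have [_ -> _] := jc l i; rewrite scaler0.
Qed.

Lemma gen_space_sub N G (l : 'I_(ngroups G)) : (0 < len l)%N ->
  (gen_space l <= chain_space N l)%VS.
Proof.
by move=> l0; rewrite chain_spaceE (sumv_sup (Ordinal l0)).
Qed.

Lemma jordan_gen_ker S N G (l : 'I_(ngroups G)) : jordan_bases S N G ->
  (l < nker G)%N -> (gen_space l <= lker S)%VS.
Proof.
move=> jb lk; apply: subv_trans (gen_space_sub N (jordan_len0 l jb)) _.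
have [_ _ _ /span_basis <- _] := jb.
by rewrite span_chains_where (sumv_sup l).
Qed.

Lemma jordan_gen_limg S N G (l : 'I_(ngroups G)) : jordan_bases S N G ->
  ~~ (l < nker G)%N -> (gen_space l <= limg S)%VS.
Proof.
move=> jb lk; apply: subv_trans (gen_space_sub N (jordan_len0 l jb)) _.
have [_ _ _ _ /span_basis <-] := jb.
by rewrite span_chains_where (sumv_sup l).
Qed.

(** Freeness of the chains is a matter of counting: a family that spans V and has
   at most dim V members is a basis of V, so its members in ker S and in im S,
   two complementary subspaces, are bases of these. *)
Lemma jordan_bases_count S N G : semisimple S -> (forall v, S (N v) = N (S v)) ->
  (nker G <= ngroups G)%N ->
  (forall l : 'I_(ngroups G), [/\ (0 < len l)%N, (0 < nvec l)%N &
     forall v, v \in gen_space l -> iter (len l) N v = 0]) ->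
  (forall l : 'I_(ngroups G),
     (gen_space l <= if (l < nker G)%N then lker S else limg S)%VS) ->
  (\sum_l \sum_(i < len l) iter i (lfun_img N) (gen_space (G := G) l))%VS = fullv ->
  (\sum_(l < ngroups G) len l * nvec l <= \dim {:V})%N ->
  jordan_bases S N G.
Proof.
move=> ss SN nk lg sub sp le; have [dKI fKI] := semisimple_ker_limg ss.
pose P := fun l : 'I_(ngroups G) => (l < nker G)%N.
have bV : basis_of fullv (chains_where N (predT : pred 'I_(ngroups G))).
  rewrite basisEdim size_chains_where le andbT span_chains_where.
  by rewrite -sp; apply/subv_sumP => l _; rewrite (sumv_sup l) // chain_spaceE.
have fr : free (all_chains N G).
  by rewrite (perm_free (perm_all_chains N G)) (basis_free bV).
have NK v : v \in lker S -> N v \in lker S.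
  by rewrite !memv_ker SN => /eqP ->; rewrite linear0.
have NI v : v \in limg S -> N v \in limg S.
  by move=> /memv_imgP[u _ ->]; rewrite -SN memv_img ?memvf.
have stc l : (chain_space N l <= if P l then lker S else limg S)%VS.
  rewrite chain_spaceE; apply/subv_sumP => i _; apply/subvP => _ /memv_iter_limgP[u ul ->].
  have := subvP (sub l) u ul; rewrite -/(P l).
  by move=> ul'; elim: (nat_of_ord i) => //= j; case: (P l); [exact: NK | exact: NI].
have sk : (<<chains_where N P>> <= lker S)%VS.
  by rewrite span_chains_where; apply/subv_sumP => l Pl; have := stc l; rewrite Pl.
have si : (<<chains_where N (fun l => ~~ P l)>> <= limg S)%VS.
  rewrite span_chains_where; apply/subv_sumP => l Pl; have := stc l.
  by rewrite (negPf Pl).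
have fc : free (chains_where N P ++ chains_where N (fun l => ~~ P l)).
  by rewrite (perm_free (perm_chainsC N P)) (basis_free bV).
have spc : (<<chains_where N P>> + <<chains_where N (fun l => ~~ P l)>> = fullv)%VS.
  by rewrite -span_cat (eq_mem_span (perm_chainsC N P)) (span_basis bV).
have dd : (\dim (lker S) + \dim (limg S) = \dim {:V})%N.
  by rewrite -dimv_disjoint_sum // fKI.
have ds : (\dim <<chains_where N P>> + \dim <<chains_where N (fun l => ~~ P l)>>
    = \dim {:V})%N.
  have /eqP -> := catl_free fc; have /eqP -> := catr_free fc.
  by rewrite -size_cat (perm_size (perm_chainsC N P)) -(eqP (basis_free bV))
     (span_basis bV).
split=> //.
- by move=> l; have [] := lg l.
- move=> l j; have [l0 v0 Nl] := lg l; split=> //.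
    by apply/Nl/memv_span/mem_tnth.
  have le1 : ((len l).-1 < len l)%N by rewrite ltn_predL.
  have fi := iter_gen_free fr le1.
  by apply: (free_not0 fi); apply/map_f/mem_tnth.
- rewrite /basis_of (catl_free fc) andbT eqEdim sk /=.
  by rewrite -(leq_add2r (\dim (limg S))) dd -ds leq_add2l dimvS.
- rewrite /basis_of (catr_free fc) andbT eqEdim si /=.
  by rewrite -(leq_add2l (\dim (lker S))) dd -ds leq_add2r dimvS.
Qed.

End Chains.

(** * Block matrices of families of chains *)

Lemma sum_tagnat (M : nmodType) n (p : 'I_n -> nat) (F : forall i, 'I_(p i) -> M) :
  \sum_(s < (\sum_i p i)%N) F (tagnat.sig1 s) (tagnat.sig2 s) =
  \sum_i \sum_j F i j.
Proof. by rewrite sig_big_dep /= (reindex _ tagnat.sig_bij_on). Qed.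

Section BlockMatrices.
Variables (k : fieldType) (V : vectType k).
Implicit Types (A S N : 'End(V)) (G : generators V).

Lemma matrix_of_mxdiag n (p : 'I_n -> nat) (c : forall l, (p l).-tuple V)
    (M : forall l, 'M[k]_(p l)) A
    (e := [tuple tnth (c (tagnat.sig1 s)) (tagnat.sig2 s) | s < (\sum_l p l)%N]) :
  free e -> (forall l j, A (tnth (c l) j) = \sum_i M l i j *: tnth (c l) i) ->
  matrix_of e A = \mxdiag_l M l.
Proof.
move=> fe h; apply: matrix_ofP => // s; rewrite tnth_mktuple.
pose l0 := tagnat.sig1 s; pose j0 := tagnat.sig2 s.
rewrite h; under [RHS]eq_bigr do rewrite mxE tnth_mktuple.
rewrite (sum_tagnat (fun l (j : 'I_(p l)) =>
  (if l == l0 then conform_mx 0 (M l) else 0 : 'M_(p l, p l0)) j j0 *: tnth (c l) j)).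
rewrite (bigD1 l0) //= [X in _ + X]big1 ?addr0 => [|l ne]; last first.
  by rewrite (negPf ne); apply: big1 => j _; rewrite mxE scale0r.
by rewrite eqxx conform_mx_id.
Qed.

(** S acts by C inside each row of the diagram and N moves a row to the next one, the
    last row to 0. *)
Lemma matrix_of_chain_tuple S N G (l : 'I_(ngroups G)) (C : 'M[k]_(nvec l)) :
  (forall v, S (N v) = N (S v)) -> free (chain_tuple N l) ->
  (forall v, v \in gen_space l -> iter (len l) N v = 0) ->
  (forall j, S (tnth (gen l) j) = \sum_i C i j *: tnth (gen l) i) ->
  matrix_of (chain_tuple N l) (S + N) = Dblock (len l) C.
Proof.
move=> SN fr N0 SC; apply: matrix_ofP => // s; rewrite tnth_mktuple.
pose a := tagnat.sig1 s; pose b := tagnat.sig2 s.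
under [RHS]eq_bigr do rewrite mxE tnth_mktuple.
rewrite (sum_tagnat (fun i (j : 'I_(nvec l)) =>
  (if i == a then C else if i == a.+1 :> nat then 1%:M else 0) j b
     *: iter i N (tnth (gen l) j))).
rewrite add_lfunE iter_commute // SC iter_linear_sum -iterS.
rewrite (bigD1 a) //= eqxx; congr (_ + _).
  by apply: eq_bigr => j _; rewrite iter_linearZ.
have one i : \sum_j (1%:M : 'M[k]_(nvec l)) j b *: iter i N (tnth (gen l) j) =
    iter i N (tnth (gen l) b).
  rewrite (bigD1 b) //= mxE eqxx scale1r big1 ?addr0 // => j ne.
  by rewrite mxE (negPf ne) scale0r.
rewrite -/a -/b; have [lt|] := ltnP a.+1 (len l).
  rewrite (bigD1 (Ordinal lt)) /=; last by rewrite -val_eqE /= gtn_eqF.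
  rewrite -val_eqE /= gtn_eqF // eqxx (one a.+1) big1 ?addr0 // => i /andP[ia ia'].
  rewrite (negPf ia) -[i == a.+1 :> nat]/(i == Ordinal lt) (negPf ia').
  by apply: big1 => j _; rewrite mxE scale0r.
rewrite leq_eqVlt ltnNge ltn_ord orbF => /eqP E; rewrite big1 => [|i ia].
  by rewrite -iterS -E N0 // memv_span // mem_tnth.
rewrite (negPf ia) ltn_eqF -?E //; apply: big1 => j _; rewrite mxE scale0r //.
Qed.

End BlockMatrices.

(** * Stable Young diagrams *)

Section YoungDecomposition.
Variables (k : fieldType) (V : vectType k).
Implicit Types (f g S N : 'End(V)) (K E X : {vspace V}).

Lemma stable_cap f X E : stable f X -> stable f E -> stable f (X :&: E)%VS.
Proof.
move=> /stableP sX /stableP sE; apply/stableP => v.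
by rewrite !memv_cap => /andP[/sX -> /sE ->].
Qed.

Lemma stable_lker_commute f g : (forall v, f (g v) = g (f v)) -> stable f (lker g).
Proof.
by move=> fg; apply/stableP => v; rewrite !memv_ker -fg => /eqP ->; rewrite linear0.
Qed.

Lemma stable_limg_commute f g E : (forall v, f (g v) = g (f v)) ->
  stable f E -> stable f (g @: E)%VS.
Proof.
move=> fg /stableP sE; apply/stableP => _ /memv_imgP[v vE ->].
by rewrite fg memv_img ?sE.
Qed.

Lemma stable_iter_limg f g E i : (forall v, f (g v) = g (f v)) ->
  stable f E -> stable f (iter i (lfun_img g) E).
Proof. by move=> fg sE; elim: i => //= i; apply: stable_limg_commute. Qed.

Lemma relative_complement S X E : semisimple S -> stable S X -> stable S E ->
  (X <= E)%VS -> exists Y, [/\ stable S Y, (Y <= E)%VS, (X :&: Y = 0)%VS & (X + Y)%VS = E].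
Proof.
move=> ss sX sE XE; have [W [sW fW dW]] := ss X sX.
exists (W :&: E)%VS; split; [exact: stable_cap|exact: capvSr| |].
  by rewrite capvA dW cap0v.
by rewrite vspace_modl // fW capfv.
Qed.

Definition column_space N (x : nat * {vspace V}) : {vspace V} :=
  (\sum_(i < x.1) iter i (lfun_img N) x.2)%VS.

(** The last clause says that the number of chains is the dimension of ker N in K; it
    is what makes the counting of vectors pass from N K to K. *)
Definition young_decomposition S N K (t : seq (nat * {vspace V})) :=
  [/\ forall x, x \in t -> [/\ (0 < x.1)%N, x.2 != 0%VS, stable S x.2, (x.2 <= K)%VS
        & forall v, v \in x.2 -> iter x.1 N v = 0],
      sorted gtn [seq x.1 | x <- t],
      (\sum_(x <- t) column_space N x)%VS = K,
      (\sum_(x <- t) x.1 * \dim x.2)%N = \dim K &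
      (\sum_(x <- t) \dim x.2)%N = \dim (K :&: lker N)].

(** A stable complement of the kernel of N in the preimage of a space is mapped onto
    that space without loss of dimension. *)
Lemma young_lift S N K (t : seq (nat * {vspace V})) : semisimple S ->
  (forall v, S (N v) = N (S v)) -> stable S K ->
  (forall x, x \in t -> stable S x.2 /\ (x.2 <= N @: K)%VS) ->
  exists2 t', [seq (x.1.-1, (N @: x.2)%VS) | x <- t'] = t &
    forall x, x \in t' -> [/\ (0 < x.1)%N, stable S x.2, (x.2 <= K)%VS &
      (x.2 :&: lker N = 0)%VS].
Proof.
move=> ss SN sK; elim: t => [|[m F] t IH] tP; first by exists [::].
have [|t' tt' t'P] := IH; first by move=> x xt; apply: tP; rewrite inE xt orbT.
have [/= sF FK] := tP (m, F) (mem_head _ _).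
pose E := (K :&: (N @^-1: F))%VS.
have sE : stable S E.
  apply: stable_cap => //; apply/stableP => v; rewrite -!memv_preim -SN.
  by move/stableP: sF; apply.
have sX : stable S (E :&: lker N)%VS.
  by apply: stable_cap => //; apply: stable_lker_commute => v; rewrite SN.
have [Y [sY YE dY fY]] := relative_complement ss sX sE (capvSl _ _).
exists ((m.+1, Y) :: t') => [|x].
  rewrite /= tt'; congr ((_, _) :: _); apply/eqP; rewrite eqEsubv; apply/andP; split.
    apply/subvP => _ /memv_imgP[v vY ->].
    by have := subvP YE v vY; rewrite memv_cap -memv_preim => /andP[].
  apply/subvP => w wF; have /memv_imgP[u uK wE] := subvP FK w wF.
  have: u \in E by rewrite memv_cap uK -memv_preim -wE.
  rewrite -fY => /memv_addP[a aX [b bY uE]]; rewrite wE uE linearD /=.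
  move: aX; rewrite memv_cap memv_ker => /andP[_ /eqP ->].
  by rewrite add0r memv_img.
rewrite inE => /orP[/eqP -> /=|/t'P //]; split=> //.
  exact: subv_trans YE (capvSl _ _).
apply/eqP; rewrite -subv0 -dY; apply/subvP => v.
rewrite memv_cap => /andP[vY vN].
by rewrite memv_cap vY andbT memv_cap vN andbT (subvP YE).
Qed.

(** The chains of N in N K are prolonged by one vector below, and new chains of length
    1 are taken from a complement of ker N in N K inside ker N in K.  Complements are
    taken among the S-stable subspaces. *)
Lemma young_decomposition_exists S N n K : semisimple S ->
  (forall v, S (N v) = N (S v)) -> stable S K -> stable N K ->
  (forall v, v \in K -> iter n N v = 0) -> exists t, young_decomposition S N K t.
Proof.
move=> ss SN; elim: n K => [|n IHn] K sK nK K0.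
  have -> : K = 0%VS.
    by apply/eqP; rewrite -subv0; apply/subvP => v /K0 /= ->; rewrite mem0v.
  by exists [::]; split; rewrite ?big_nil ?cap0v ?dimv0.
pose K1 := (N @: K)%VS; have K1K : (K1 <= K)%VS by [].
have [|||t1 [t1P so1 sp1 d1 c1]] := IHn K1.
- exact: stable_limg_commute.
- exact: limgS.
- by move=> _ /memv_imgP[v vK ->]; rewrite -iterSr K0.
have [|t2 t12 t2P] := @young_lift S N K t1 ss SN sK.
  by move=> x /t1P[].
have sk : stable S (lker N) by apply: stable_lker_commute => v; rewrite SN.
have [|||F1 [sF1 F1K dF1 fF1]] := @relative_complement S (K1 :&: lker N) (K :&: lker N) ss.
- by apply: stable_cap => //; apply: stable_limg_commute.
- exact: stable_cap.
- exact: capvS.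
pose t3 := if F1 == 0%VS then [::] else [:: (1%N, F1)].
have big3 R (idx : R) (op : Monoid.law idx) (h : nat * {vspace V} -> R) :
    h (1%N, 0%VS) = idx -> \big[op/idx]_(x <- t3) h x = h (1%N, F1).
  move=> g0; rewrite /t3; case: eqP => [->|_]; first by rewrite big_nil g0.
  by rewrite big_seq1.
have col1 F : column_space N (1%N, F) = F by rewrite /column_space /= big_ord1.
have t2P' x : x \in t2 -> [/\ (1 < x.1)%N, x.2 != 0%VS &
    (forall v, v \in x.2 -> iter x.1 N v = 0)].
  move=> xt; have := map_f (fun x : nat * _ => (x.1.-1, N @: x.2)%VS) xt; rewrite t12.
  case/t1P => /= x1 x2 _ _ xN; split.
  - by lia.
  - by apply: contraNneq x2 => ->; rewrite limg0.
  - move=> v vx; have [x0 _ _ _] := t2P x xt.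
    by rewrite -(prednK x0) iterSr xN // memv_img.
have d2 x : x \in t2 -> \dim (N @: x.2)%VS = \dim x.2.
  by move=> /t2P[_ _ _ /limg_dim_eq].
(* t2 holds the prolonged columns, t3 the new columns of length 1. *)
exists (t2 ++ t3); split.
- move=> x; rewrite mem_cat => /orP[xt|].
    have [x0 sx xK _] := t2P x xt; have [_ x20 xN] := t2P' x xt; split=> //.
  rewrite /t3; case: eqP => // /eqP F10; rewrite inE => /eqP -> /=; split=> //.
    exact: subv_trans F1K (capvSl _ _).
  by move=> v /(subvP F1K); rewrite memv_cap memv_ker => /andP[_ /eqP].
- have so2 : sorted gtn [seq x.1 | x <- t2].
    have : sorted gtn [seq x.-1 | x <- [seq x.1 | x <- t2]].
      by rewrite -map_comp; move: so1; rewrite -t12 -map_comp.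
    rewrite sorted_map; apply: (@sub_in_sorted _ (fun x => 0 < x)%N).
      by move=> x y; rewrite -!topredE /= => x0 y0; lia.
    by apply/allP => _ /mapP[x xt ->]; have [] := t2P x xt.
  rewrite /t3; case: eqP => _; rewrite ?cats0 // map_cat /= cats1.
  case: t2 so2 t2P' {t12 t2P d2} => [|x t2] //= so2 t2P'.
  rewrite rcons_path so2 /=; have : last x.1 [seq x.1 | x <- t2] \in [seq x.1 | x <- x :: t2].
    exact: mem_last.
  by case/mapP => y /t2P'[y1 _ _] ->.
- rewrite big_cat /= (big3 _ _ _ (column_space N)); last exact: col1.
  rewrite col1; set T := (\sum_(x <- t2) _)%VS.
  have N2 : K1 = (N @: (\sum_(x <- t2) column_space N (x.1.-1, x.2)))%VS.
    rewrite -sp1 -t12 big_map limg_sum; apply: eq_bigr => x _.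
    rewrite limg_sum; apply: eq_bigr => i _ /=; rewrite -iterSr //.
  have T'T : (\sum_(x <- t2) column_space N (x.1.-1, x.2) <= T)%VS.
    rewrite /T !big_seq; apply: (big_ind2 (fun A B => A <= B)%VS) => [|????|x xt].
    - exact: subvv.
    - exact: addvS.
    have [x0 _ _ _] := t2P x xt; apply/subv_sumP => i _ /=.
    have il : (i < x.1)%N by case: i => i /=; lia.
    by rewrite (sumv_sup (Ordinal il)).
  have K1T : (K1 <= T)%VS.
    rewrite N2 limg_sum /T !big_seq; apply: (big_ind2 (fun A B => A <= B)%VS) => [|????|x xt].
    - exact: subvv.
    - exact: addvS.
    have [x0 _ _ _] := t2P x xt; rewrite limg_sum; apply/subv_sumP => i _ /=.
    have il : (i.+1 < x.1)%N by case: i => i /=; lia.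
    by rewrite (sumv_sup (Ordinal il)).
  apply/eqP; rewrite eqEsubv; apply/andP; split.
    rewrite subv_add (subv_trans F1K) ?capvSl // andbT /T big_seq.
    apply: (big_ind (fun A => A <= K)%VS) => [|A B AK BK|x xt]; first exact: sub0v.
      by rewrite subv_add AK.
    have [_ _ xK _] := t2P x xt; apply/subv_sumP => i _.
    by elim: (nat_of_ord i) => //= j IH; apply: subv_trans nK; apply: limgS.
  apply/subvP => v vK; have : N v \in K1 by apply: memv_img.
  rewrite N2 => /memv_imgP[y yT' Nvy].
  have yK : y \in K.
    have TK : (T <= K)%VS.
      rewrite /T big_seq; apply: (big_ind (fun A => A <= K)%VS) => [|A B AK BK|x xt].
      - exact: sub0v.
      - by rewrite subv_add AK.
      have [_ _ xK _] := t2P x xt; apply/subv_sumP => i _.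
      by elim: (nat_of_ord i) => //= j IH; apply: subv_trans nK; apply: limgS.
    by apply: (subvP TK); apply: (subvP T'T).
  have : v - y \in (K :&: lker N)%VS.
    by rewrite memv_cap rpredB //= memv_ker linearB /= Nvy subrr.
  rewrite -fF1 => /memv_addP[a aX [b bF E]].
  rewrite -[v](subrK y) E addrC addrA; apply: memv_add => //; apply: rpredD.
    exact: subvP T'T _ yT'.
  by apply: (subvP K1T); move: aX; rewrite memv_cap => /andP[].
- rewrite big_cat /= (big3 _ _ _ (fun x => x.1 * \dim x.2)%N) ?dimv0 //= mul1n.
  rewrite -(limg_ker_dim N K) -fF1 (dimv_disjoint_sum dF1) -c1 -/K1 -d1 -t12 !big_map /=.
  suff -> : (\sum_(x <- t2) x.1 * \dim x.2 = \sum_(x <- t2) \dim (N @: x.2)%VS +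
    \sum_(x <- t2) x.1.-1 * \dim (N @: x.2)%VS)%N by lia.
  rewrite -big_split /= !big_seq; apply: eq_bigr => x xt; rewrite d2 //.
  by have [x0 _ _ _] := t2P x xt; rewrite -{1}(prednK x0) mulSn.
- rewrite big_cat /= (big3 _ _ _ (fun x => \dim x.2)%N) ?dimv0 //=.
  rewrite -fF1 (dimv_disjoint_sum dF1) -c1 -t12 big_map /=; congr (_ + _)%N.
  by rewrite !big_seq; apply: eq_bigr => x xt; rewrite d2.
Qed.

End YoungDecomposition.

(** * Cyclic decomposition of a semisimple map *)

Lemma max_nat_classic (Q : nat -> Prop) b : (exists n, Q n) ->
  (forall n, Q n -> (n <= b)%N) -> exists2 n, Q n & forall m, Q m -> (m <= n)%N.
Proof.
elim: b => [|b IH] exQ leb.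
  by case: exQ => n Qn; exists n => // m /leb; rewrite leqn0 => /eqP ->.
case: (classic (Q b.+1)) => Qb; first by exists b.+1.
by apply: IH => // n Qn; have := leb n Qn; rewrite leq_eqVlt => /orP[/eqP E|//]; rewrite E in Qn.
Qed.

Section PolyAction.
Variables (k : fieldType) (U : lmodType k).
Implicit Types (f g : {linear U -> U}) (p q : {poly k}) (v : U).

(** The k[X]-module structure that f defines on U; it is spelled out by iterates
    because these are the vectors of the chains. *)
Definition pact (f : U -> U) p v := \sum_(i < size p) p`_i *: iter i f v.

Lemma pactE n f p v : (size p <= n)%N -> pact f p v = \sum_(i < n) p`_i *: iter i f v.
Proof.
move=> le; rewrite /pact (big_ord_widen n (fun i => p`_i *: iter i f v) le).
rewrite big_mkcond; apply: eq_bigr => i _; case: ltnP => // ge.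
by rewrite nth_default // scale0r.
Qed.

Lemma pactD f p q v : pact f (p + q) v = pact f p v + pact f q v.
Proof.
pose n := maxn (size p) (size q).
rewrite (@pactE n _ (p + q)) ?size_polyD // (@pactE n _ p) ?leq_maxl //.
rewrite (@pactE n _ q) ?leq_maxr // -big_split /=.
by apply: eq_bigr => i _; rewrite coefD scalerDl.
Qed.

Lemma pactZ f a p v : pact f (a *: p) v = a *: pact f p v.
Proof.
rewrite (@pactE (size p)) ?size_scale_leq // /pact scaler_sumr.
by apply: eq_bigr => i _; rewrite coefZ scalerA.
Qed.

Lemma pactC f a v : pact f a%:P v = a *: v.
Proof. by rewrite (@pactE 1) ?size_polyC_leq1 // big_ord1 coefC. Qed.

Lemma pact0 f v : pact f 0 v = 0.
Proof. by rewrite pactC scale0r. Qed.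

Lemma pactMX f p v : pact f (p * 'X) v = f (pact f p v).
Proof.
have [->|p0] := eqVneq p 0; first by rewrite mul0r pact0 linear0.
rewrite (@pactE (size p).+1) ?size_mulX // big_ord_recl coefMX /= scale0r add0r.
rewrite /pact linear_sum; apply: eq_bigr => i _.
by rewrite /bump coefMX /= linearZ_LR.
Qed.

Lemma pact_linear f p : linear (pact f p).
Proof.
move=> a u v; rewrite /pact scaler_sumr -big_split /=; apply: eq_bigr => i _.
by rewrite iter_linearD iter_linearZ scalerDr !scalerA mulrC.
Qed.

HB.instance Definition _ f p :=
  GRing.isLinear.Build k U U *:%R (pact f p) (@pact_linear f p).

Lemma pactMXC f p c v : pact f (p * 'X + c%:P) v = f (pact f p v) + c *: v.
Proof. by rewrite pactD pactMX pactC. Qed.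

Lemma pactM f p q v : pact f (p * q) v = pact f p (pact f q v).
Proof.
elim/poly_ind: p => [|p c IH]; first by rewrite mul0r !pact0.
rewrite mulrDl mulrAC pactD pactMX IH mul_polyC pactZ pactMXC.
by congr (_ + _).
Qed.

Lemma pactXn f n v : pact f 'X^n v = iter n f v.
Proof.
elim: n => [|n IH]; first by rewrite expr0 pactC scale1r.
by rewrite exprSr pactMX IH.
Qed.

Lemma pact_commute f g p v : (forall v, g (f v) = f (g v)) ->
  g (pact f p v) = pact f p (g v).
Proof.
move=> gf; rewrite /pact linear_sum; apply: eq_bigr => i _.
by rewrite linearZ_LR /= iter_commute.
Qed.

Lemma pact_iter_commute f g p i v : (forall v, g (f v) = f (g v)) ->
  iter i g (pact f p v) = pact f p (iter i g v).
Proof. by move=> gf; elim: i => //= i ->; apply: pact_commute. Qed.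

Lemma pact_dvd f p q v : p %| q -> pact f p v = 0 -> pact f q v = 0.
Proof. by move=> /divpK <- pv; rewrite pactM pv linear0. Qed.

Section MinimalPolynomial.
Variables (f : {linear U -> U}) (v : U) (m : nat) (p : {poly k}).
Hypotheses (pm : p \is monic) (sp : size p = m.+1) (pv : pact f p v = 0).

Lemma pact_modp r : pact f r v = pact f (r %% p) v.
Proof. by rewrite {1}(divp_eq r p) pactD pactM pv linear0 add0r. Qed.

Lemma size_modp_ann r : (size (r %% p)%R <= m)%N.
Proof. by rewrite -ltnS -sp ltn_modp monic_neq0. Qed.

(** The hypothesis says that v, f v, ..., f^(m-1) v are independent. *)
Lemma pact_eq0_dvd r :
  (forall c : {poly k}, (size c <= m)%N -> pact f c v = 0 -> c = 0) ->
  (pact f r v == 0) = (p %| r).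
Proof.
move=> fr; apply/eqP/idP => [|/pact_dvd]; last exact.
by rewrite pact_modp => /(fr _ (size_modp_ann r)) /eqP.
Qed.

End MinimalPolynomial.

End PolyAction.

Section Krylov.
Variables (k : fieldType) (V : vectType k) (f : 'End(V)).
Implicit Types (W F : {vspace V}) (p q : {poly k}) (v : V).

Definition krylov m v : m.-tuple V := [tuple iter i f v | i < m].

Lemma krylovE m v : krylov m v = mkseq (fun i => iter i f v) m :> seq V.
Proof. by rewrite /= /mkseq -val_enum_ord -map_comp. Qed.

Lemma krylov_nth m v (i : 'I_m) : (krylov m v)`_i = iter i f v.
Proof. by rewrite -tnth_nth tnth_mktuple. Qed.

Lemma stable_iter W v i : stable f W -> v \in W -> iter i f v \in W.
Proof. by move=> /stableP st vW; elim: i => //= i /st. Qed.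

Lemma stable_pact W v p : stable f W -> v \in W -> pact f p v \in W.
Proof. by move=> st vW; apply: rpred_sum => i _; rewrite rpredZ ?stable_iter. Qed.

Lemma krylov_spanP m v w : w \in <<krylov m v>>%VS ->
  exists2 r : {poly k}, (size r <= m)%N & w = pact f r v.
Proof.
move/coord_span => E; pose c i := oapp (fun j => coord (krylov m v) j w) 0 (insub i).
exists (\poly_(i < m) c i); first exact: size_poly.
rewrite (@pactE _ _ m) ?size_poly // {1}E; apply: eq_bigr => i _.
by rewrite krylov_nth coef_poly ltn_ord /c valK.
Qed.

Lemma pact_krylov m v p : (size p <= m)%N -> pact f p v \in <<krylov m v>>%VS.
Proof.
move=> le; rewrite (pactE _ _ le); apply: rpred_sum => i _.
by rewrite rpredZ // -(krylov_nth v i) memv_span // mem_nth // size_tuple.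
Qed.

Lemma krylov_mem m v : (0 < m)%N -> v \in <<krylov m v>>%VS.
Proof.
move=> m0; have : pact f 'X^0 v \in <<krylov m v>>%VS.
  by rewrite pact_krylov // size_polyXn.
by rewrite pactXn.
Qed.

Lemma krylov_free_eq0 m v p : free (krylov m v) -> (size p <= m)%N ->
  pact f p v = 0 -> p = 0.
Proof.
move=> /freeP fr le; rewrite (pactE _ _ le) => E.
apply/polyP => i; rewrite coef0; have [lt|ge] := ltnP i m; last first.
  by rewrite nth_default // (leq_trans le).
apply: (fr (fun i : 'I_m => p`_i) _ (Ordinal lt)); rewrite -[RHS]E.
by apply: eq_bigr => j _; rewrite krylov_nth.
Qed.

Section MinimalPolynomial.
Variables (v : V) (m : nat) (p : {poly k}).
Hypotheses (pm : p \is monic) (sp : size p = m.+1) (pv : pact f p v = 0).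

Lemma krylov_stable : stable f <<krylov m v>>%VS.
Proof.
apply/stableP => _ /krylov_spanP[r _ ->].
by rewrite -pactMX (pact_modp pv) pact_krylov // (size_modp_ann pm sp).
Qed.

Lemma ann_dvd r : free (krylov m v) -> (pact f r v == 0) = (p %| r).
Proof.
move=> fr; apply: (pact_eq0_dvd pm sp pv) => c; exact: krylov_free_eq0.
Qed.

Lemma dim_krylov_le : (\dim <<krylov m v>> <= m)%N.
Proof. by rewrite (leq_trans (dim_span _)) // size_tuple. Qed.

End MinimalPolynomial.

Lemma krylovS m v : perm_eq (krylov m.+1 v) (iter m f v :: krylov m v).
Proof.
by rewrite !krylovE /mkseq -addn1 iotaD map_cat /= add0n cats1 perm_rcons.
Qed.

(** Freeness of the first deg p iterates makes p the minimal polynomial of f at v. *)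
Definition annihilator v p :=
  [/\ p \is monic, pact f p v = 0 & free (krylov (size p).-1 v)].

Lemma annihilator_exists v : exists p, annihilator v p.
Proof.
pose P m := iter m f v \in <<krylov m v>>%VS.
have frP m : free (krylov m v) || [exists j : 'I_m, P j].
  elim: m => [|m /orP[fr|/existsP[j Pj]]]; first by rewrite (tuple0 (krylov 0 v)) nil_free.
    case: (boolP (P m)) => [Pm|nP].
      by apply/orP; right; apply/existsP; exists ord_max.
    by rewrite (perm_free (krylovS m v)) free_cons nP fr.
  by apply/orP; right; apply/existsP; exists (widen_ord (leqnSn m) j).
have exP : exists m, P m.
  have := frP (\dim {:V}).+1; rewrite orbC; case: existsP => [[j Pj]|_ fr].
    by exists j.
  have := dimvS (subvf <<krylov (\dim {:V}).+1 v>>).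
  by move: fr => /eqP ->; rewrite size_tuple ltnn.
case: (ex_minnP exP) => m Pm mmin.
have fr : free (krylov m v).
  have := frP m; case: existsP => [[j Pj]|]; last by rewrite orbF.
  by have := mmin _ Pj; have := ltn_ord j; lia.
have [r sr E] := krylov_spanP Pm.
have s : size ('X^m - r) = m.+1.
  by rewrite size_polyDl size_polyXn // size_polyN ltnS.
exists ('X^m - r); split.
- by rewrite monicE lead_coefDl ?lead_coefXn // size_polyXn size_polyN ltnS.
- by rewrite pactD pactXn E -scaleN1r pactZ scaleN1r subrr.
- by rewrite s.
Qed.

Lemma annihilator_dvd v p r : annihilator v p -> (pact f r v == 0) = (p %| r).
Proof.
move=> [pm pv fr]; apply: (@ann_dvd v (size p).-1) => //.
by rewrite prednK // lt0n size_poly_eq0 monic_neq0.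
Qed.

Lemma annihilator_size v p : annihilator v p -> (size p <= (\dim {:V}).+1)%N.
Proof.
move=> [_ _ /eqP fr].
have := dimvS (subvf <<krylov (size p).-1 v>>); rewrite fr size_tuple; lia.
Qed.

Lemma annihilator_size_gt1 v p : annihilator v p -> v != 0 -> (1 < size p)%N.
Proof.
move=> [pm pv _]; apply: contraNltn => le1; move: pv pm.
rewrite (size1_polyC le1) monicE lead_coefC pactC => pv /eqP p1.
by rewrite -pv p1 scale1r.
Qed.

Definition cyclic_decomposition F (t : seq (V * {poly k})) :=
  [/\ forall x, x \in t -> annihilator x.1 x.2 /\ (1 < size x.2)%N,
      pairwise (fun x y : V * {poly k} => y.2 %| x.2) t,
      (\sum_(x <- t) <<krylov (size x.2).-1 x.1>>)%VS = F &
      (\sum_(x <- t) (size x.2).-1)%N = \dim F].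

(** The rational canonical form of a semisimple map.  Let v in F have an
    annihilator p of the largest possible degree, and let W be a stable
    complement in F of the cyclic space of v.  For w in W with annihilator p',
    the annihilator of v + w is a multiple of p and of p', so it is p and p'
    divides p. *)
Lemma cyclic_decomposition_exists F : semisimple f -> stable f F ->
  exists t, cyclic_decomposition F t.
Proof.
move=> ss; have [n] := ubnP (\dim F); elim: n F => // n IHn F ltn sF.
have [->|F0] := eqVneq F 0%VS; first by exists [::]; split; rewrite ?big_nil ?dimv0.
pose Q n := exists v p, [/\ v \in F, annihilator v p & size p = n].
have [||sz [v [p [vF pv sp]]] maxp] := @max_nat_classic Q (\dim {:V}).+1.
- by have [p pP] := annihilator_exists 0; exists (size p), 0, p; rewrite mem0v.
- by move=> _ [v [p [_ /annihilator_size le <-]]].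
have p_gt1 : (1 < size p)%N.
  have [q qP] := annihilator_exists (vpick F).
  have := annihilator_size_gt1 qP; rewrite vpick0 => /(_ F0) /leq_trans -> //.
  by rewrite sp; apply: maxp; exists (vpick F), q; rewrite memv_pick.
have [pm pv0 fr] := pv; have sp' : size p = (size p).-1.+1 by rewrite prednK //; lia.
pose C := <<krylov (size p).-1 v>>%VS.
have sC : stable f C by apply: krylov_stable pv0.
have CF : (C <= F)%VS.
  by apply/span_subvP => _ /mapP[i _ ->]; apply: stable_iter.
have dC : \dim C = (size p).-1 by rewrite (eqP fr) size_tuple.
have vC : v \in C.
  by apply: krylov_mem; lia.
have [W [sW WF dW fW]] := relative_complement ss sC sF CF.
have dF : \dim F = ((size p).-1 + \dim W)%N by rewrite -fW dimv_disjoint_sum ?dC.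
have [|t [tP tsort tsum tdim]] := IHn W _ sW; first by lia.
have dvd w q : w \in W -> annihilator w q -> q %| p.
  move=> wW qw; have [r rP] := annihilator_exists (v + w).
  have : r %| r by [].
  rewrite -(annihilator_dvd _ rP) linearD /= addr_eq0 => /eqP E.
  have rv : pact f r v = 0.
    apply/eqP; rewrite -memv0 -dW memv_cap stable_pact //= E rpredN.
    exact: stable_pact.
  have pr : p %| r by rewrite -(annihilator_dvd _ pv) rv.
  have le : (size r <= size p)%N.
    rewrite sp; apply: maxp; exists (v + w), r; split=> //.
    by rewrite rpredD // (subvP WF).
  have /eqp_dvdr <- : r %= p.
    rewrite eqp_sym -dvdp_size_eqp // eqn_leq le andbT dvdp_leq //.
    by have [/monic_neq0] := rP.
  by rewrite -(annihilator_dvd _ qw) -[pact f r w]opprK -E rv oppr0.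
exists ((v, p) :: t); split.
- by move=> x; rewrite inE => /orP[/eqP -> //|/tP].
- rewrite pairwise_cons tsort andbT; apply/allP => x xt /=.
  have [xa sx] := tP x xt; apply: dvd xa.
  rewrite -tsum (big_rem _ xt) /=; apply: (subvP (addvSl _ _)).
  by apply: krylov_mem; move: sx; case: (size _) => [|[]].
- by rewrite big_cons tsum fW.
- by rewrite big_cons tdim dF.
Qed.

End Krylov.

(** * Refinement of the generating spaces by cyclic vectors *)

Lemma char_poly_trmx (k : fieldType) n (A : 'M[k]_n) : char_poly A^T = char_poly A.
Proof.
rewrite /char_poly -det_tr; congr (\det _).
by rewrite /char_poly_mx linearB /= map_trmx trmxK tr_scalar_mx.
Qed.

Lemma char_poly_companion (k : fieldType) m (p : {poly k}) : p \is monic ->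
  size p = m.+1 -> char_poly (companion m p) = p.
Proof.
move=> pm /(congr1 predn) /= <-; rewrite -[RHS](companionmxK pm) -char_poly_trmx.
congr char_poly; apply/matrixP => i j; rewrite !mxE.
have -> : (i == (size p).-1.-1 :> nat) = (i.+1 == (size p).-1).
  by case: (size p).-1 i => [[]|d i].
by rewrite [j == i.+1 :> nat]eq_sym.
Qed.

Section KrylovCompanion.
Variables (k : fieldType) (V : vectType k) (S : 'End(V)).

Lemma krylov_apply m v (p : {poly k}) (j : 'I_m) : p \is monic -> size p = m.+1 ->
  pact S p v = 0 -> S (tnth (krylov S m v) j) =
    \sum_i companion m p i j *: tnth (krylov S m v) i.
Proof.
move=> pm sp pv; rewrite tnth_mktuple -iterS.
under eq_bigr do rewrite mxE tnth_mktuple.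
have [E|ne] := eqVneq j.+1 m.
  rewrite E; move: pv; rewrite /pact sp big_ord_recr /=.
  have -> : p`_m = 1 by move: pm; rewrite monicE lead_coefE sp => /eqP.
  rewrite scale1r addrC => /eqP; rewrite addr_eq0 => /eqP ->.
  by rewrite -sumrN; apply: eq_bigr => i _; rewrite scaleNr.
have lt : (j.+1 < m)%N by have := ltn_ord j; lia.
rewrite (bigD1 (Ordinal lt)) //= eqxx scale1r big1 ?addr0 // => i.
by rewrite -val_eqE /= => /negPf ->; rewrite scale0r.
Qed.

Lemma char_poly_krylov m v (p : {poly k}) : p \is monic -> size p = m.+1 ->
  pact S p v = 0 -> free (krylov S m v) -> char_poly_on S <<krylov S m v>>%VS = p.
Proof.
move=> pm sp pv fr.
have bk : basis_of <<krylov S m v>>%VS (krylov S m v) by rewrite /basis_of eqxx fr.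
rewrite -(char_poly_basis bk (krylov_stable pm sp pv)).
rewrite (matrix_ofP fr (M := companion m p)) ?char_poly_companion // => j.
exact: krylov_apply.
Qed.

End KrylovCompanion.

Section Refinement.
Variables (k : fieldType) (V : vectType k) (S N : 'End(V)).
Hypotheses (ss : semisimple S) (SN : forall v, S (N v) = N (S v)).

Definition krylov_generators p (r : nat) (len q : 'I_p -> nat) (v : 'I_p -> V) :
    generators V := Generators r len (fun i => krylov S (q i) (v i)).

(** The vectors v i generate cyclic S-spaces, with annihilators P i, that split the
    spaces of generating vectors of G. *)
Record refining_data (G : generators V) p (pi : 'I_p -> 'I_(ngroups G)) r
    (q : 'I_p -> nat) (v : 'I_p -> V) (P : 'I_p -> {poly k}) : Prop := {
  rd_nker : (r <= p)%N;
  rd_flag : forall i : 'I_p, (i < r)%N = (pi i < nker G)%N;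
  rd_mono : forall i i' : 'I_p, (i <= i')%N -> (pi i <= pi i')%N;
  rd_q : forall i, (0 < q i)%N;
  rd_monic : forall i, P i \is monic;
  rd_size : forall i, size (P i) = (q i).+1;
  rd_kill : forall i, pact S (P i) (v i) = 0;
  rd_dvd : forall i i' : 'I_p, (i <= i')%N -> pi i = pi i' -> P i' %| P i;
  rd_sum : forall l, (\sum_(i | pi i == l) <<krylov S (q i) (v i)>>)%VS = gen_space l;
  rd_dim : forall l, (\sum_(i | pi i == l) q i)%N = \dim (gen_space l) }.

Lemma sum_leq_eq (I : finType) (Q : pred I) (F F' : I -> nat) :
  (forall i, Q i -> (F i <= F' i)%N) -> (\sum_(i | Q i) F' i <= \sum_(i | Q i) F i)%N ->
  forall i, Q i -> F i = F' i.
Proof.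
move=> le ge i Qi; apply/eqP; rewrite eqn_leq le //=.
move: ge; rewrite (bigD1 i Qi) /= [leqRHS](bigD1 i Qi) /=.
have : (\sum_(j | Q j && (j != i)) F j <= \sum_(j | Q j && (j != i)) F' j)%N.
  by apply: leq_sum => j /andP[Qj _]; apply: le.
lia.
Qed.

(** By rd_sum and rd_dim the cyclic spaces have the largest dimension they can have,
    so their Krylov families are free and their sum is direct. *)
Lemma refining_data_refines G p (pi : 'I_p -> 'I_(ngroups G)) r q v P
    (H := krylov_generators r (fun i => len (pi i)) q v) :
  jordan_bases S N G -> refining_data pi r q v P ->
  refines S N (H := H) pi /\ companion_bases S H.
Proof.
move=> jG [nk flag mono q0 Pm Ps Pv Pd Psum Pdim].
have fG := jordan_full ss jG.
have fr i : free (krylov S (q i) (v i)).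
  rewrite /free size_tuple; apply/eqP.
  apply: (@sum_leq_eq _ (fun j => pi j == pi i) (fun j => \dim <<krylov S (q j) (v j)>>)).
  - by move=> j _; apply: dim_krylov_le.
  - by rewrite Pdim -Psum dimv_leq_sum.
  - exact: eqxx.
have st i : stable S <<krylov S (q i) (v i)>>%VS by apply: krylov_stable (Pv i).
have dimk i : \dim <<krylov S (q i) (v i)>> = q i by rewrite (eqP (fr i)) size_tuple.
have sub i : (<<krylov S (q i) (v i)>> <= gen_space (pi i))%VS.
  by rewrite -Psum (sumv_sup i).
have dG l : \dim (gen_space (G := G) l) = nvec l.
  rewrite /gen_space; have /eqP -> := gen_free (basis_free fG) (jordan_len0 l jG).
  by rewrite size_tuple.
split; last first.
  move=> i; split; first by rewrite /basis_of eqxx fr.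
  rewrite /companion_on /= /gen_space /= (char_poly_krylov (Pm i) (Ps i) (Pv i) (fr i)).
  apply: matrix_ofP (fr i) _ => j; exact: krylov_apply.
split.
- apply: jordan_bases_count => //.
  + move=> i; split=> //=; first exact: jordan_len0 jG.
    by move=> w /(subvP (sub i)); apply: gen_iter_len jG.
  + move=> i; apply: subv_trans (sub i) _; rewrite /= flag; case: ifP => lk.
      exact: jordan_gen_ker jG lk.
    by apply: jordan_gen_limg jG _; rewrite lk.
  + rewrite -(span_basis fG) span_all_chains (partition_big pi predT) //=.
    apply: eq_bigr => l _; rewrite chain_spaceE -Psum.
    rewrite (eq_bigr (fun i => \sum_(j < len l)
       iter j (lfun_img N) <<krylov S (q i) (v i)>>)%VS); last by move=> i /eqP <-.
    rewrite exchange_big /=; apply: eq_bigr => j _; elim: (nat_of_ord j) => //= n IH.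
    by rewrite -limg_sum IH.
  + rewrite -(span_basis fG) (eqP (basis_free fG)) size_tuple /=.
    rewrite (partition_big pi predT) //=; apply: leq_sum => l _.
    rewrite sum_nat_const card_ord -dG -Pdim big_distrr /=.
    by apply: leq_sum => i /eqP ->.
- by move=> i; rewrite flag.
- exact: mono.
- move=> l; split; last exact: Psum.
  by rewrite directvE /= [X in \dim X](Psum l) -Pdim; apply/eqP/eq_bigr => i _; rewrite dimk.
split=> [i|i i' ii' e]; first exact: st.
rewrite /gen_space /= !(char_poly_krylov (Pm _) (Ps _) (Pv _) (fr _)).
exact: Pd.
Qed.

(** In a list sorted by key, the members with a small key come first; so the summands
    of the spaces in ker S precede the others. *)
Lemma count_key_lt (T : eqType) (key : T -> nat) (t : seq T) c (x0 : T) i :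
  pairwise (fun x y => key x <= key y)%N t -> (i < size t)%N ->
  (i < count (fun x => key x < c)%N t)%N = (key (nth x0 t i) < c)%N.
Proof.
elim: t i => // x t IH i /= /andP[/allP ax pt] it.
have [xc|cx] := ltnP (key x) c; first by case: i it => // i /(IH i pt).
have ge y : y \in t -> (key y < c)%N = false.
  by move=> /ax xy; apply/negbTE; rewrite -leqNgt (leq_trans cx).
rewrite add0n (eq_in_count (a2 := pred0)) ?count_pred0 //.
case: i it => [_|i it] /=; first by rewrite [RHS]ltnNge cx.
by rewrite ge ?mem_nth.
Qed.

Lemma pairwise_groups (I T : eqType) (ri : rel I) (rT : rel T) (ts : I -> seq T) s :
  pairwise ri s -> (forall l, pairwise rT (ts l)) ->
  pairwise (fun x y : I * T => ri x.1 y.1 || ((x.1 == y.1) && rT x.2 y.2))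
    [seq (l, x) | l <- s, x <- ts l].
Proof.
move=> + pT; elim: s => //= l s IH /andP[/allP al ps].
rewrite pairwise_cat IH // andbT pairwise_map; apply/andP; split; last first.
  by apply: sub_pairwise (pT l) => x y /= ->; rewrite eqxx orbT.
apply/allrelP => _ _ /mapP[x _ ->] /allpairsPdep[l' [x' [l's _ ->]]] /=.
by rewrite al.
Qed.

Lemma refining_data_exists G : (forall l, stable S (gen_space (G := G) l)) ->
  (nker G <= ngroups G)%N ->
  exists p (pi : 'I_p -> 'I_(ngroups G)) r q v P, refining_data pi r q v P.
Proof.
move=> st nk.
have [ts tsP] := functional_choice _ (fun l => cyclic_decomposition_exists ss (st l)).
pose t := [seq (l, x) | l <- enum 'I_(ngroups G), x <- ts l].
pose x_ (i : 'I_(size t)) := tnth (in_tuple t) i.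
have x_t i : x_ i \in t by apply: mem_tnth.
have x_ts i : (x_ i).2 \in ts (x_ i).1.
  by have /allpairsPdep[l [x [_ xt ->]]] := x_t i.
have an i : annihilator S (x_ i).2.1 (x_ i).2.2 /\ (1 < size (x_ i).2.2)%N.
  by have [tP _ _ _] := tsP (x_ i).1; apply/tP/x_ts.
have sz i : size (x_ i).2.2 = (size (x_ i).2.2).-1.+1.
  by have [_] := an i; case: (size _).
have pw : pairwise (fun x y : 'I_(ngroups G) * (V * {poly k}) =>
    (x.1 < y.1)%N || ((x.1 == y.1) && (y.2.2 %| x.2.2))) t.
  apply: (@pairwise_groups _ _ (fun l l' : 'I_(ngroups G) => l < l')%N
            (fun x y : V * {poly k} => y.2 %| x.2)).
    by rewrite -(pairwise_map val ltn) val_enum_ord -sorted_pairwise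
      ?iota_ltn_sorted //; exact: ltn_trans.
  by move=> l; have [] := tsP l.
have pw1 : pairwise (fun x y : 'I_(ngroups G) * (V * {poly k}) => x.1 <= y.1)%N t.
  apply: sub_pairwise pw => x y /orP[/ltnW //|/andP[/eqP -> _]]; exact: leqnn.
have lt_rel (i i' : 'I_(size t)) : (i < i')%N ->
    (((x_ i).1 < (x_ i').1)%N || (((x_ i).1 == (x_ i').1) && ((x_ i').2.2 %| (x_ i).2.2))).
  move=> ii'; rewrite /x_ !(tnth_nth (x_ i)) /=.
  by apply: (pairwiseP (x_ i) pw) => //; rewrite inE.
have sumE (R : Type) (idx : R) (op : Monoid.com_law idx) (F : V * {poly k} -> R) l :
    \big[op/idx]_(i | (x_ i).1 == l) F (x_ i).2 = \big[op/idx]_(x <- ts l) F x.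
  rewrite -(big_tnth _ _ t (fun x => x.1 == l) (fun x => F x.2)) /t big_mkcond.
  rewrite big_allpairs_dep /= big_enum /= (bigD1 l) //=.
  rewrite [X in op _ X]big1 ?Monoid.mulm1 => [|l' /negPf ne].
    by apply: eq_bigr => x _; rewrite eqxx.
  by rewrite big1 // => x _; rewrite ne.
pose r := count (fun x : 'I_(ngroups G) * (V * {poly k}) => x.1 < nker G)%N t.
exists (size t), (fun i => (x_ i).1), r, (fun i => (size (x_ i).2.2).-1),
  (fun i => (x_ i).2.1), (fun i => (x_ i).2.2); split => //.
- exact: count_size.
- move=> i; rewrite /r (@count_key_lt _ (fun x => nat_of_ord x.1) t (nker G) (x_ i)) //.
  by rewrite [in RHS](_ : x_ i = nth (x_ i) t i) //; apply: tnth_nth.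
- move=> i i'; rewrite leq_eqVlt => /orP[/eqP/val_inj -> //|/lt_rel].
  by case/orP => [/ltnW //|/andP[/eqP -> _]].
- by move=> i; have [_] := an i; case: (size _) => [|[]].
- by move=> i; have [[]] := an i.
- by move=> i; have [[]] := an i.
- move=> i i'; rewrite leq_eqVlt => /orP[/eqP/val_inj -> //|/lt_rel].
  by case/orP => [lt E|/andP[_ ->] //]; rewrite E ltnn in lt.
- move=> l; have [_ _ <- _] := tsP l.
  by rewrite (sumE _ _ _ (fun x => <<krylov S (size x.2).-1 x.1>>%VS)).
- move=> l; have [_ _ _ <-] := tsP l.
  by rewrite (sumE _ _ _ (fun x => (size x.2).-1)).
Qed.

End Refinement.

(** * Diagrams and normal form of a Jordan decomposition *)

Section NormalForm.
Variables (k : fieldType) (V : vectType k) (A S N : 'End(V)).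
Hypothesis jd : jordan_decomposition A S N.

Let ss : semisimple S. Proof. by have [] := jd. Qed.
Let SN v : S (N v) = N (S v).
Proof. by have [_ /lfunP/(_ v)] := jd; rewrite !comp_lfunE. Qed.

(** The decreasing lengths on im S are what lets the algorithm find the generators
    one after the other. *)
Lemma young_bases_exist : exists G : generators V, [/\ young_bases S N G,
  forall l : 'I_(ngroups G), stable S (gen_space l) &
  forall l l' : 'I_(ngroups G), (nker G <= l)%N -> (l <= l')%N -> (len l' <= len l)%N].
Proof.
have [dKI fKI] := semisimple_ker_limg ss.
have [_ _ _ [n N0]] := jd.
have [||t0 [t0P so0 sp0 d0 _]] :=
    @young_decomposition_exists _ _ S N n (lker S) ss SN _ _ (fun v _ => N0 v).
- exact: stable_lker_commute.
- by apply: stable_lker_commute => v; rewrite SN.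
have [||t1 [t1P so1 sp1 d1 _]] :=
    @young_decomposition_exists _ _ S N n (limg S) ss SN _ _ (fun v _ => N0 v).
- by apply: stable_limg_commute => //; apply: subvf.
- by apply: stable_limg_commute => [v|]; rewrite ?SN //; apply: subvf.
pose t := t0 ++ t1; pose d := (0%N, 0%VS : {vspace V}).
pose x_ (l : 'I_(size t)) := nth d t l.
pose G := Generators (size t0) (fun l => (x_ l).1) (fun l => vbasis (x_ l).2).
have xt l : x_ l \in t by apply: mem_nth.
have gE (l : 'I_(ngroups G)) : gen_space l = (x_ l).2.
  exact: (span_basis (vbasisP _)).
have tP (x : nat * {vspace V}) : x \in t -> [/\ (0 < x.1)%N, x.2 != 0%VS, stable S x.2
        & forall v, v \in x.2 -> iter x.1 N v = 0].
  by rewrite mem_cat => /orP[/t0P|/t1P] [].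
have sumE (R : Type) (idx : R) (op : Monoid.com_law idx) (F : nat * {vspace V} -> R) :
    \big[op/idx]_(l < size t) F (x_ l) =
    op (\big[op/idx]_(x <- t0) F x) (\big[op/idx]_(x <- t1) F x).
  by rewrite -big_cat -/t (big_nth d) big_mkord.
have [xlo xhi] : (forall l : 'I_(size t), (l < size t0)%N -> x_ l = nth d t0 l) /\
   (forall l : 'I_(size t), (size t0 <= l)%N -> x_ l = nth d t1 (l - size t0)).
  by split=> l lk; rewrite /x_ nth_cat ?lk // ltnNge lk.
have szl (l : 'I_(size t)) : (size t0 <= l)%N -> (l - size t0 < size t1)%N.
  by move=> ge; rewrite ltn_subLR // -size_cat.
have nth1 (s : seq (nat * {vspace V})) i : (nth d s i).1 = nth 0%N [seq x.1 | x <- s] i.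
  have [lt|ge] := ltnP i (size s); first by rewrite (nth_map d).
  by rewrite !nth_default ?size_map.
have ltn_gtn : transitive gtn by move=> a b c /= ab bc; apply: ltn_trans bc ab.
have uniq1 (s : seq (nat * {vspace V})) i j : sorted gtn [seq x.1 | x <- s] ->
    (i < size s)%N -> (j < size s)%N -> (nth d s i).1 = (nth d s j).1 -> i = j.
  move=> so si sj; rewrite !nth1 => /eqP.
  rewrite nth_uniq ?size_map // => [/eqP //|].
  by apply: sorted_uniq so => // a /=; rewrite ltnn.
exists G; split.
- split=> [|l l']; last first.
    case: (ltnP l) => lk /esym; case: (ltnP l') => // lk' _ /=.
      rewrite !xlo // => E; apply/val_inj; exact: uniq1 E.
    rewrite !xhi // => /uniq1 E; apply/val_inj; apply/eqP => /=.
    by rewrite -(eqn_add2r 0) -(subnK lk) -(subnK lk') E // szl.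
  apply: jordan_bases_count => //.
  + by rewrite /= size_cat leq_addr.
  + move=> l; have [x0 F0 _ xN] := tP _ (xt l); split=> //.
    * by rewrite /= lt0n dimv_eq0.
    * by move=> v; rewrite gE => /xN.
  + move=> l; rewrite gE /=; case: ltnP => lk.
      by rewrite xlo //; have [] := t0P _ (mem_nth d lk).
    by rewrite xhi //; have [] := t1P _ (mem_nth d (szl l lk)).
  + under eq_bigr => l _ do rewrite gE.
    by rewrite (sumE _ _ _ (column_space N)) sp0 sp1; exact: fKI.
  + by rewrite (sumE _ _ _ (fun x => x.1 * \dim x.2)%N) d0 d1 -[in leqRHS]fKI dimv_disjoint_sum.
- by move=> l; rewrite gE; have [] := tP _ (xt l).
- move=> l l' lk ll'; rewrite /= !xhi ?(leq_trans lk) // !nth1.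
  have : sorted geq [seq x.1 | x <- t1] by apply: sub_sorted so1 => a b /= /ltnW.
  move=> so; apply: (sorted_leq_nth _ _ 0%N so).
  + by move=> a b c /= ab bc; apply: leq_trans bc ab.
  + by move=> a; apply: leqnn.
  + by rewrite inE size_map szl.
  + by rewrite inE size_map szl // (leq_trans lk).
  + exact: leq_sub2r.
Qed.

(** N^i commutes with S and is injective on the generating space as long as i is
    smaller than the length of the chains. *)
Lemma chain_char_polys G : jordan_bases S N G ->
  (forall l : 'I_(ngroups G), stable S (gen_space l)) ->
  (forall l : 'I_(ngroups G), stable S (chain_space N l) /\
     char_poly_on S (chain_space N l) = char_poly_on S (gen_space l) ^+ len l) /\
  char_poly_on S fullv = \prod_(l < ngroups G) char_poly_on S (gen_space l) ^+ len l.
Proof.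
move=> jG st; have bG := jordan_full ss jG; have fG := basis_free bG.
have sti l i : stable S (iter i (lfun_img N) (gen_space (G := G) l)).
  exact: stable_iter_limg.
have stc (l : 'I_(ngroups G)) : stable S (chain_space N l).
  by rewrite chain_spaceE; apply: stable_sum.
have dc (l : 'I_(ngroups G)) : char_poly_on S (chain_space N l) =
    char_poly_on S (gen_space l) ^+ len l.
  rewrite chain_spaceE char_poly_on_sum //; last first.
    by rewrite -(directvP (chain_space_direct fG l)).
  rewrite -[in RHS](card_ord (len l)) -prodr_const; apply: eq_bigr => i _.
  rewrite iter_limgE char_poly_on_limg //.
    by move=> v; rewrite !lfunE /= /iterl iter_commute.
  apply/eqP; rewrite -dimv_eq0 -(eqn_add2r (\dim (linfun (iterl N i) @: gen_space l))).
  rewrite limg_ker_dim -iter_limgE dim_iter_gen_space // add0n; apply/eqP.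
  exact: (dim_iter_gen_space fG (jordan_len0 l jG)).
split=> //; rewrite -(span_basis bG) span_all_chains char_poly_on_sum //.
  by apply: eq_bigr => l _.
by rewrite -(directvP (sum_chain_space_direct fG)).
Qed.

Lemma refined_normal_form H : jordan_bases S N H -> companion_bases S H ->
  (forall i : 'I_(ngroups H), stable S (gen_space i)) ->
  [/\ forall i : 'I_(ngroups H), (i < nker H)%N -> companion_on S i = 0,
      forall i : 'I_(ngroups H),
        [/\ stable A (chain_space N i), basis_of (chain_space N i) (chain_tuple N i) &
            matrix_of (chain_tuple N i) A = Dblock (len i) (companion_on S i)] &
      basis_of fullv (all_chains N H) /\
      matrix_of (all_chains N H) A = normal_form S H].
Proof.
move=> jH cH st; have bH := jordan_full ss jH; have fH := basis_free bH.
have AE : A = S + N by have [] := jd.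
have [stc _] := chain_char_polys jH st.
have bc (i : 'I_(ngroups H)) : basis_of (chain_space N i) (chain_tuple N i).
  by rewrite /basis_of eqxx chain_tuple_free.
have mc (i : 'I_(ngroups H)) :
    matrix_of (chain_tuple N i) A = Dblock (len i) (companion_on S i).
  rewrite AE; have [bg <-] := cH i; apply: matrix_of_chain_tuple => //.
  - exact: chain_tuple_free.
  - by move=> v; apply: gen_iter_len jH.
  - by move=> j; apply: matrix_of_sum bg (st i).
have sta (i : 'I_(ngroups H)) : stable A (chain_space N i).
  rewrite AE; apply/stableP => v vc; rewrite add_lfunE rpredD //.
    by have /stableP := (stc i).1; apply.
  move: vc; rewrite !chain_spaceE => vc.
  suff : (N @: (\sum_(j < len i) iter j (lfun_img N) (gen_space i)) <=
     \sum_(j < len i) iter j (lfun_img N) (gen_space i))%VS.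
    by move/stableP; apply.
  rewrite limg_sum; apply/subv_sumP => j _; have [lt|ge] := ltnP j.+1 (len i).
    by rewrite (sumv_sup (Ordinal lt)).
  have E : j.+1 = len i by apply/eqP; rewrite eqn_leq ge ltn_ord.
  apply/subvP => w; rewrite -[(N @: _)%VS]/(iter j.+1 (lfun_img N) (gen_space i)).
  by case/memv_iter_limgP => u ui ->; rewrite E (gen_iter_len jH) // mem0v.
split=> //.
  move=> i ik; have [_ <-] := cH i; apply/matrixP => a b; rewrite !mxE.
  have : tnth (gen i) b \in lker S.
    by apply: (subvP (jordan_gen_ker jH ik)); rewrite memv_span // mem_tnth.
  by rewrite memv_ker => /eqP ->; rewrite linear0.
split=> //; rewrite /normal_form; apply: matrix_of_mxdiag; first exact: fH.
by move=> l j; rewrite -mc; apply: matrix_of_sum (bc l) (sta l).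
Qed.

End NormalForm.

(** * Rational functions of the entries, guesses and tests *)

Section Rational.
Variables (k : fieldType) (I : Type).
Local Notation E := (I -> k).

Definition rational (f : E -> k) := exists e : field_expr I, forall env, f env = feval env e.

Lemma eq_rational f g : f =1 g -> rational f -> rational g.
Proof. by move=> fg [e fe]; exists e => env; rewrite -fg. Qed.

Lemma rational_var i : rational (fun env => env i).
Proof. by exists (FVar i). Qed.

Lemma rational0 : rational (fun=> 0).
Proof. by exists FZero. Qed.

Lemma rational1 : rational (fun=> 1).
Proof. by exists FOne. Qed.

Lemma rationalD f g : rational f -> rational g -> rational (fun env => f env + g env).
Proof. by move=> [a fa] [b gb]; exists (FAdd a b) => env /=; rewrite fa gb. Qed.

Lemma rationalM f g : rational f -> rational g -> rational (fun env => f env * g env).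
Proof. by move=> [a fa] [b gb]; exists (FMul a b) => env /=; rewrite fa gb. Qed.

Lemma rationalN f : rational f -> rational (fun env => - f env).
Proof. by move=> [a fa]; exists (FOpp a) => env /=; rewrite fa. Qed.

Lemma rationalV f : rational f -> rational (fun env => (f env)^-1).
Proof. by move=> [a fa]; exists (FInv a) => env /=; rewrite fa. Qed.

Lemma rational_sum J (r : seq J) (P : pred J) (F : J -> E -> k) :
  (forall j, rational (F j)) -> rational (fun env => \sum_(j <- r | P j) F j env).
Proof.
move=> rF; elim: r => [|j r IH].
  by apply: eq_rational rational0 => env; rewrite big_nil.
case Pj: (P j).
  apply: eq_rational (rationalD (rF j) IH) => env.
  by rewrite big_cons Pj.
by apply: eq_rational IH => env; rewrite big_cons Pj.
Qed.

Lemma rational_prod J (r : seq J) (P : pred J) (F : J -> E -> k) :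
  (forall j, rational (F j)) -> rational (fun env => \prod_(j <- r | P j) F j env).
Proof.
move=> rF; elim: r => [|j r IH].
  by apply: eq_rational rational1 => env; rewrite big_nil.
case Pj: (P j).
  apply: eq_rational (rationalM (rF j) IH) => env.
  by rewrite big_cons Pj.
by apply: eq_rational IH => env; rewrite big_cons Pj.
Qed.

Lemma rational_nat n : rational (fun=> n%:R).
Proof.
elim: n => [|n IH]; first exact: rational0.
by apply: eq_rational (rationalD rational1 IH) => env; rewrite mulrS.
Qed.

Lemma rational_sign n : rational (fun=> (-1) ^+ n).
Proof.
elim: n => [|n IH]; first exact: rational1.
by apply: eq_rational (rationalN IH) => env; rewrite exprS mulN1r.
Qed.

Definition rational_mx m n (f : E -> 'M[k]_(m, n)) :=
  forall i j, rational (fun env => f env i j).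

Lemma rational_mx_expr m n (f : E -> 'M[k]_(m, n)) : rational_mx f ->
  exists X : 'M[field_expr I]_(m, n), forall env, f env = map_mx (feval env) X.
Proof.
move=> rf; have [e eP] := functional_choice _ (fun ij => rf ij.1 ij.2).
exists (\matrix_(i, j) e (i, j)) => env; apply/matrixP => i j.
by rewrite !mxE (eP (i, j)).
Qed.

Lemma eq_rational_mx m n (f g : E -> 'M[k]_(m, n)) :
  f =1 g -> rational_mx f -> rational_mx g.
Proof. by move=> fg rf i j; apply: eq_rational (rf i j) => env; rewrite fg. Qed.

Lemma rational_mx0 m n : rational_mx (fun=> 0 : 'M[k]_(m, n)).
Proof. by move=> i j; apply: eq_rational rational0 => env; rewrite mxE. Qed.

Lemma rational_mx_scalar n (f : E -> k) : rational f ->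
  rational_mx (fun env => (f env)%:M : 'M[k]_n).
Proof.
move=> rf i j; case: (boolP (i == j)) => ij.
  by apply: eq_rational rf => env; rewrite mxE ij.
by apply: eq_rational rational0 => env; rewrite mxE (negPf ij).
Qed.

Lemma rational_mx_delta m n i j : rational_mx (fun=> delta_mx i j : 'M[k]_(m, n)).
Proof. by move=> x y; apply: eq_rational (rational_nat _) => env; rewrite mxE. Qed.

Lemma rational_mxD m n (f g : E -> 'M[k]_(m, n)) : rational_mx f -> rational_mx g ->
  rational_mx (fun env => f env + g env).
Proof.
move=> rf rg i j; apply: eq_rational (rationalD (rf i j) (rg i j)) => env.
by rewrite mxE.
Qed.

Lemma rational_mxN m n (f : E -> 'M[k]_(m, n)) : rational_mx f ->
  rational_mx (fun env => - f env).
Proof. by move=> rf i j; apply: eq_rational (rationalN (rf i j)) => env; rewrite mxE. Qed.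

Lemma rational_mxZ m n (c : E -> k) (f : E -> 'M[k]_(m, n)) : rational c ->
  rational_mx f -> rational_mx (fun env => c env *: f env).
Proof.
by move=> rc rf i j; apply: eq_rational (rationalM rc (rf i j)) => env; rewrite mxE.
Qed.

Lemma rational_mx_mul m n p (f : E -> 'M[k]_(m, n)) (g : E -> 'M[k]_(n, p)) :
  rational_mx f -> rational_mx g -> rational_mx (fun env => f env *m g env).
Proof.
move=> rf rg i j.
apply: eq_rational (rational_sum _ predT (fun l => rationalM (rf i l) (rg l j))) => env.
by rewrite mxE.
Qed.

Lemma rational_mx_sum m n J (r : seq J) (P : pred J) (F : J -> E -> 'M[k]_(m, n)) :
  (forall j, rational_mx (F j)) -> rational_mx (fun env => \sum_(j <- r | P j) F j env).
Proof.
move=> rF x y; apply: eq_rational (rational_sum r P (fun j => rF j x y)) => env.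
by rewrite summxE.
Qed.

Lemma rational_mx_iter m n i (f : E -> 'M[k]_m) (g : E -> 'M[k]_(m, n)) :
  rational_mx f -> rational_mx g -> rational_mx (fun env => iter i (mulmx (f env)) (g env)).
Proof. by move=> rf rg; elim: i => //= i IH; apply: rational_mx_mul. Qed.

Lemma rational_det n (f : E -> 'M[k]_n) : rational_mx f -> rational (fun env => \det (f env)).
Proof.
move=> rf; apply: rational_sum => s; apply: rationalM; first exact: rational_sign.
by apply: rational_prod => i; apply: rf.
Qed.

Lemma rational_adj n (f : E -> 'M[k]_n) : rational_mx f ->
  rational_mx (fun env => \adj (f env)).
Proof.
move=> rf i j; apply: (@eq_rational (fun env => cofactor (f env) j i)).
  by move=> env; rewrite mxE.
apply: rationalM; first exact: rational_sign.
by apply: rational_det => x y; apply: eq_rational (rf _ _) => env; rewrite !mxE.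
Qed.

(** A finite list of rational functions, one of which is right at every point;
    which one it is may depend on the point. *)
Definition guess T (rT : (E -> T) -> Prop) (Q : E -> T -> Prop) :=
  exists (C : finType) (F : C -> E -> T),
    (forall c, rT (F c)) /\ forall env, exists c, Q env (F c env).

Lemma guess_ret T (rT : (E -> T) -> Prop) (Q : E -> T -> Prop) f :
  rT f -> (forall env, Q env (f env)) -> guess rT Q.
Proof. by move=> rf Qf; exists unit, (fun=> f); split=> // env; exists tt. Qed.

Lemma guess_sub T (rT : (E -> T) -> Prop) (Q Q' : E -> T -> Prop) :
  (forall env y, Q env y -> Q' env y) -> guess rT Q -> guess rT Q'.
Proof.
move=> QQ' [C [F [rF QF]]]; exists C, F; split=> // env.
by have [c /QQ'] := QF env; exists c.
Qed.

Lemma guess_union T (rT : (E -> T) -> Prop) (D : finType) (QD : D -> E -> T -> Prop)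
    (Q : E -> T -> Prop) :
  (forall d, guess rT (QD d)) ->
  (forall env, exists d, forall y, QD d env y -> Q env y) -> guess rT Q.
Proof.
move=> gD QDQ.
have ch d : {C : finType & {F : C -> E -> T |
    (forall c, rT (F c)) /\ forall env, exists c, QD d env (F c env)}}.
  have [C HC] := constructive_indefinite_description _ (gD d).
  by have [F HF] := constructive_indefinite_description _ HC; exists C, F.
pose C d : finType := tag (ch d).
pose F d : C d -> E -> T := sval (tagged (ch d)).
have FP d : (forall c, rT (F d c)) /\ forall env, exists c, QD d env (F d c env).
  exact: svalP (tagged (ch d)).
exists {d : D & C d}, (fun x => F (tag x) (tagged x)); split.
  by move=> [d c]; apply: (FP d).1.
move=> env; have [d dP] := QDQ env; have [c cP] := (FP d).2 env.
by exists (Tagged C c); apply: dP.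
Qed.

Lemma guess_bind T T' (rT : (E -> T) -> Prop) (rT' : (E -> T') -> Prop)
    (Q : E -> T -> Prop) (Q' : E -> T' -> Prop) :
  guess rT Q ->
  (forall f, rT f -> guess rT' (fun env y => Q env (f env) -> Q' env y)) ->
  guess rT' Q'.
Proof.
move=> [C [F [rF QF]]] h.
apply: (@guess_union _ _ C (fun c env y => Q env (F c env) -> Q' env y)).
  by move=> c; apply: h.
by move=> env; have [c cP] := QF env; exists c => y; apply.
Qed.

(** X' has a zero row i and a zero column j, and the two outer factors turn X into X'
    from the right and from the left. *)
Lemma pivot_ginverse m n (X : 'M[k]_(m, n)) i j (a := X i j)
    (X' := X - a^-1 *: (col j X *m row i X)) (Y' : 'M[k]_(n, m)) :
  a != 0 -> X' *m Y' *m X' = X' ->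
  X *m ((1%:M - a^-1 *: (delta_mx j 0 *m row i X)) *m Y' *m
        (1%:M - a^-1 *: (col j X *m delta_mx 0 i)) + a^-1 *: delta_mx j i) *m X = X.
Proof.
move=> a0 h.
set P := 1%:M - _ *: (delta_mx j 0 *m _); set Q := 1%:M - _ *: (_ *m delta_mx 0 i).
have XP : X *m P = X' by rewrite mulmxBr mulmx1 -scalemxAr mulmxA -colE.
have QX : Q *m X = X' by rewrite mulmxBl mul1mx -scalemxAl -mulmxA -rowE.
rewrite mulmxDr mulmxDl !mulmxA XP -(mulmxA _ Q X) QX h -scalemxAr -scalemxAl.
have -> : X *m delta_mx j i *m X = col j X *m row i X.
  by rewrite -(mul_delta_mx (0 : 'I_1)) mulmxA -colE -mulmxA -rowE.
by rewrite subrK.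
Qed.

(** The law X Y X = X suffices to solve linear systems and to describe kernels.
    Elimination by pivoting gives such a Y: subtracting a matrix of rank one kills the row of
    the pivot and keeps the rows that are already zero. *)
Lemma guess_ginverse m n (f : E -> 'M[k]_(m, n)) : rational_mx f ->
  guess (@rational_mx n m) (fun env Y => f env *m Y *m f env = f env).
Proof.
move=> rf; suff h d : guess (@rational_mx n m) (fun env Y =>
    (#|[set i | row i (f env) != 0%R]| <= d)%N -> f env *m Y *m f env = f env).
  apply: guess_sub (h m) => env y; apply.
  by rewrite (leq_trans (max_card _)) // card_ord.
(* The number of nonzero rows bounds the number of pivots. *)
elim: d f rf => [|d IH] f rf.
  apply: (@guess_ret _ _ _ (fun=> 0)); first exact: rational_mx0.
  move=> env; rewrite leqn0 cards_eq0 => /eqP/setP f0.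
  suff -> : f env = 0 by rewrite mulmx0.
  by apply/row_matrixP => i; have := f0 i; rewrite !inE row0 => /negbFE/eqP.
pose QD (d0 : option ('I_m * 'I_n)) env (Y : 'M[k]_(n, m)) :=
  if d0 is Some ij then f env ij.1 ij.2 != 0 ->
    (#|[set i | row i (f env) != 0%R]| <= d.+1)%N -> f env *m Y *m f env = f env
  else Y = 0.
apply: (@guess_union _ _ _ QD); last first.
  move=> env; have [->|] := eqVneq (f env) 0.
    by exists None => y /= ->; rewrite mulmx0.
  by case/matrix0Pn => i [j nz]; exists (Some (i, j)) => y /= /(_ nz).
case=> [[i j]|]; last by apply: (@guess_ret _ _ _ (fun=> 0)) => //; apply: rational_mx0.
have rrow : rational_mx (fun env => row i (f env)).
  by move=> x y; apply: eq_rational (rf i y) => env; rewrite mxE.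
have rcol : rational_mx (fun env => col j (f env)).
  by move=> x y; apply: eq_rational (rf x j) => env; rewrite mxE.
have rV : rational (fun env => (f env i j)^-1) by apply: rationalV; apply: rf.
pose f' env := f env - (f env i j)^-1 *: (col j (f env) *m row i (f env)).
have rf' : rational_mx f'.
  apply: rational_mxD => //; apply: rational_mxN; apply: rational_mxZ => //.
  exact: rational_mx_mul.
apply: guess_bind (IH f' rf') _ => Y' rY'.
apply: (@guess_ret _ _ _ (fun env =>
  (1%:M - (f env i j)^-1 *: (delta_mx j 0 *m row i (f env))) *m Y' env *m
        (1%:M - (f env i j)^-1 *: (col j (f env) *m delta_mx 0 i))
  + (f env i j)^-1 *: delta_mx j i)).
  apply: rational_mxD; last by apply: rational_mxZ => //; apply: rational_mx_delta.
  apply: rational_mx_mul; first apply: rational_mx_mul => //;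
    apply: rational_mxD; rewrite /=; try exact: rational_mx_scalar rational1;
    apply: rational_mxN; apply: rational_mxZ => //; apply: rational_mx_mul => //;
    exact: rational_mx_delta.
move=> env h nz le; apply: pivot_ginverse => //; apply: h; rewrite -ltnS.
apply: leq_trans le; apply: proper_card; apply/properP; split.
  apply/subsetP => l; rewrite !inE; apply: contraNneq => l0.
  have l0' x : f env l x = 0 by have /rowP/(_ x) := l0; rewrite !mxE.
  by apply/eqP/rowP => y; rewrite !mxE big_ord1 !mxE !l0' mul0r mulr0 subr0.
exists i; rewrite !inE.
  by apply: contraNneq nz => /rowP/(_ j); rewrite !mxE => ->.
rewrite negbK; apply/eqP/rowP => y; rewrite !mxE big_ord1 !mxE.
by rewrite mulrA mulVf // mul1r subrr.
Qed.

Definition testable (b : E -> bool) :=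
  exists t : field_tree I bool, forall env, run env t = b env.

Fixpoint tree_bind X Y (t : field_tree I X) (g : X -> field_tree I Y) : field_tree I Y :=
  match t with
  | Return x => g x
  | IfZero e t0 t1 => IfZero e (tree_bind t0 g) (tree_bind t1 g)
  end.

Lemma run_bind X Y (t : field_tree I X) (g : X -> field_tree I Y) (env : E) :
  run env (tree_bind t g) = run env (g (run env t)).
Proof. by elim: t => //= e t0 -> t1 ->; case: ifP. Qed.

Lemma eq_testable b b' : b =1 b' -> testable b -> testable b'.
Proof. by move=> bb' [t tb]; exists t => env; rewrite -bb'. Qed.

Lemma testable_const c : testable (fun=> c).
Proof. by exists (Return _ c). Qed.

Lemma testable_eq0 f : rational f -> testable (fun env => f env == 0).
Proof.
move=> [e fe]; exists (IfZero e (Return _ true) (Return _ false)) => env /=.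
by rewrite -fe; case: eqP.
Qed.

Lemma testableN b : testable b -> testable (fun env => ~~ b env).
Proof.
by move=> [t tb]; exists (tree_bind t (fun x => Return _ (~~ x))) => env;
  rewrite run_bind tb.
Qed.

Lemma testable_and b b' : testable b -> testable b' ->
  testable (fun env => b env && b' env).
Proof.
move=> [t tb] [t' tb']; exists (tree_bind t (fun x => if x then t' else Return _ false)).
by move=> env; rewrite run_bind tb; case: (b env).
Qed.

Lemma testable_forall (J : finType) (b : J -> E -> bool) :
  (forall j, testable (b j)) -> testable (fun env => [forall j, b j env]).
Proof.
move=> tb; suff h (s : seq J) : testable (fun env => all (fun j => b j env) s).
  apply: eq_testable (h (enum J)) => env.
  by apply/allP/forallP => bj j *; apply: bj; rewrite // mem_enum.
elim: s => [|j s IH]; first exact: testable_const.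
exact: testable_and.
Qed.

Lemma testable_mx_eq0 m n (f : E -> 'M[k]_(m, n)) : rational_mx f ->
  testable (fun env => f env == 0).
Proof.
move=> rf; apply: (@eq_testable (fun env => [forall i, forall j, f env i j == 0])).
  move=> env; apply/'forall_forallP/eqP => [f0|-> i j]; last by rewrite mxE.
  by apply/matrixP => i j; rewrite (eqP (f0 i j)) mxE.
by apply: testable_forall => i; apply: testable_forall => j; apply: testable_eq0.
Qed.

(** The candidates are tested one after the other. *)
Lemma tree_search (C : finType) X (x0 : X) (b : C -> E -> bool) (out : C -> X) :
  (forall c, testable (b c)) ->
  exists t : field_tree I X, forall env, (exists c, b c env) ->
    exists2 c, b c env & run env t = out c.
Proof.
move=> tb; suff h (s : seq C) : exists t : field_tree I X, forall env,
    has (fun c => b c env) s -> exists2 c, b c env & run env t = out c.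
  have [t tP] := h (enum C); exists t => env [c bc]; apply: tP.
  by apply/hasP; exists c => //; rewrite mem_enum.
elim: s => [|c s [t tP]]; first by exists (Return _ x0).
have [tc tcP] := tb c.
exists (tree_bind tc (fun x => if x then Return _ (out c) else t)) => env /=.
rewrite run_bind tcP; case: (boolP (b c env)) => [bc _|_ /= /tP //].
by exists c.
Qed.

End Rational.

(** * Generators that are rational in the entries *)

Section MonicPoly.
Variables (k : fieldType) (U : lmodType k) (f : {linear U -> U}).

(** A monic polynomial given by its lower coefficients. *)
Definition gpoly (q : nat) (a : nat -> k) : {poly k} := 'X^q + \poly_(j < q) a j.

Lemma size_gpoly q a : size (gpoly q a) = q.+1.
Proof. by rewrite size_polyDl size_polyXn // ltnS size_poly. Qed.

Lemma gpoly_monic q a : gpoly q a \is monic.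
Proof. by rewrite monicE lead_coefDl ?lead_coefXn // size_polyXn ltnS size_poly. Qed.

Lemma eq_gpoly q a a' : (forall j, (j < q)%N -> a j = a' j) -> gpoly q a = gpoly q a'.
Proof.
move=> aa'; congr (_ + _); apply/polyP => j; rewrite !coef_poly.
by case: ifP => // /aa'.
Qed.

Lemma gpolyK (p : {poly k}) q : p \is monic -> size p = q.+1 ->
  gpoly q (fun j => p`_j) = p.
Proof.
move=> pm sp; apply/polyP => j; rewrite coefD coefXn coef_poly.
have [jq|qj] := ltnP j q; first by rewrite (ltn_eqF jq) add0r.
rewrite addr0; have [->|ne] := eqVneq j q.
  by move: pm; rewrite monicE lead_coefE sp => /eqP.
by rewrite nth_default // sp; lia.
Qed.

Lemma pact_gpoly q a v :
  pact f (gpoly q a) v = iter q f v + \sum_(j < q) a j *: iter j f v.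
Proof.
rewrite pactD pactXn (@pactE _ _ q) ?size_poly //; congr (_ + _).
by apply: eq_bigr => j _; rewrite coef_poly ltn_ord.
Qed.

(** If the constant coefficient is not zero, the relation expresses v by f v, f (f v)
    and so on. *)
Lemma gpoly_invert q a v : (0 < q)%N -> a 0%N != 0 -> pact f (gpoly q a) v = 0 ->
  exists u, v = f u.
Proof.
case: q => // q _ a0; rewrite pact_gpoly big_ord_recl /= => E.
exists (- (a 0%N)^-1 *: (iter q f v + \sum_(j < q) a j.+1 *: iter j f v)).
apply: (scalerI a0); rewrite linearZ_LR /= scalerA mulrN mulfV // scaleN1r.
rewrite linearD linear_sum /=; apply/eqP; rewrite -addr_eq0 addrCA -[X in _ == X]E.
by apply/eqP; congr (_ + (_ + _)); apply: eq_bigr => j _; rewrite linearZ_LR.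
Qed.

End MonicPoly.

Section ColumnSpace.
Variables (k : fieldType) (m n : nat) (Y : 'M[k]_(m, n)).

Definition colsp (x : 'cV[k]_m) := exists y : 'cV[k]_n, x = Y *m y.

Lemma colsp0 : colsp 0.
Proof. by exists 0; rewrite mulmx0. Qed.

Lemma colspD x x' : colsp x -> colsp x' -> colsp (x + x').
Proof. by move=> [y ->] [y' ->]; exists (y + y'); rewrite mulmxDr. Qed.

Lemma colspZ a x : colsp x -> colsp (a *: x).
Proof. by move=> [y ->]; exists (a *: y); rewrite -scalemxAr. Qed.

Lemma colsp_sum J (r : seq J) (P : pred J) F : (forall j, P j -> colsp (F j)) ->
  colsp (\sum_(j <- r | P j) F j).
Proof. by move=> h; apply: (big_ind colsp); [exact: colsp0|exact: colspD|]. Qed.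

Lemma colsp_ginverse (Yg : 'M[k]_(n, m)) x : Y *m Yg *m Y = Y ->
  colsp x <-> (1%:M - Y *m Yg) *m x = 0.
Proof.
move=> YY; split=> [[y ->]|/eqP].
  by rewrite mulmxBl mul1mx mulmxA YY subrr.
by rewrite mulmxBl mul1mx subr_eq0 -mulmxA => /eqP; exists (Yg *m x).
Qed.

End ColumnSpace.

Section Genericity.
Variables (k : fieldType) (char0 : [pchar k] =i pred0).

(** The determinant is a polynomial of degree at most n in c, so it has a nonroot
    among 0, ..., n. *)
Lemma det_pencil n (A B : 'M[k]_n) (c0 : k) : \det (A + c0 *: B) != 0 ->
  exists c : 'I_n.+1, \det (A + c%:R *: B) != 0.
Proof.
pose M : 'M[{poly k}]_n := map_mx polyC A + 'X *: map_mx polyC B.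
have ME c : (\det M).[c] = \det (A + c *: B).
  rewrite -horner_evalE -det_map_mx; congr (\det _); apply/matrixP => i j.
  by rewrite !mxE /= horner_evalE !hornerE.
have sM : (size (\det M) <= n.+1)%N.
  apply: (leq_trans (size_sum _ _ _)); apply/bigmax_leqP => s _.
  have sP : (size (\prod_i M i (s i))%R <= n.+1)%N.
    apply: (leq_trans (size_poly_prod_leq _ _)); rewrite card_ord leq_subLR addnS ltnS.
    have : (\sum_(i < n) size (M i (s i)) <= \sum_(i < n) 2)%N.
      apply: leq_sum => i _; rewrite !mxE (leq_trans (size_polyD _ _)) // geq_max.
      rewrite (leq_trans (size_polyC_leq1 _)) //=.
      by rewrite (leq_trans (size_polyMleq _ _)) // size_polyX ltnS size_polyC_leq1.
    by rewrite sum_nat_const card_ord muln2 addnn.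
  by rewrite mulr_sign; case: (odd_perm _); rewrite ?size_polyN.
rewrite -ME => M0; have {}M0 : \det M != 0.
  by apply: contraNneq M0 => ->; rewrite horner0.
case: (pickP (fun c : 'I_n.+1 => (\det M).[c%:R] != 0)) => [c|no].
  by rewrite ME; exists c.
pose rs := [seq c%:R | c <- iota 0 n.+1] : seq k.
have : (size rs < size (\det M))%N.
  apply: max_poly_roots M0 _ _.
    apply/allP => _ /mapP[c cn ->]; rewrite mem_iota /= add0n in cn.
    by have /negbFE := no (Ordinal cn).
  rewrite map_inj_uniq ?iota_uniq // => c c'.
  have /pcharf0P ch := char0.
  wlog le : c c' / (c <= c')%N.
    by move=> h e; case: (leqP c c') => [/h|/ltnW /h] ->.
  move=> /eqP; rewrite eq_sym -subr_eq0 -natrB // ch subn_eq0 => le'.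
  by apply/eqP; rewrite eqn_leq le le'.
by rewrite size_map size_iota ltnNge sM.
Qed.

(** The coordinates of y0 are replaced by integers one at a time. *)
Lemma integer_point n m (F G : 'cV[k]_n -> 'M[k]_m) y0 :
  (forall y c z, F (y + c *: z) = F y + c *: G z) -> \det (F y0) != 0 ->
  exists c : 'I_n -> 'I_m.+1, \det (F (\col_i (c i)%:R)) != 0.
Proof.
move=> FG det0.
have [y dy yP] : exists2 y, \det (F y) != 0 &
    forall i : 'I_n, exists c : 'I_m.+1, y i 0 = c%:R.
  suff h l : (l <= n)%N -> exists2 y, \det (F y) != 0 &
      forall i : 'I_n, (i < l)%N -> exists c : 'I_m.+1, y i 0 = c%:R.
    by have [y dy yP] := h n (leqnn n); exists y => // i; apply: yP.
  elim: l => [|l IH] ln; first by exists y0.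
  have [y dy yP] := IH (ltnW ln); pose i0 := Ordinal ln.
  pose d : 'cV[k]_n := delta_mx i0 0; pose x := y - y i0 0 *: d.
  have yE : y = x + y i0 0 *: d by rewrite subrK.
  have := dy; rewrite {1}yE FG => /det_pencil[c dc].
  exists (x + c%:R *: d); first by rewrite FG.
  move=> i; rewrite ltnS leq_eqVlt => /orP[/eqP e|il].
    exists c; rewrite (_ : i = i0); last exact: val_inj.
    by rewrite !mxE !eqxx !mulr1 subrr add0r.
  have [c' yc] := yP i il; exists c'; rewrite -yc !mxE.
  have /negPf -> : i != i0 by rewrite -val_eqE /= ltn_eqF.
  by rewrite !mulr0 subr0 addr0.
have [c cP] := functional_choice _ yP; exists c.
by rewrite (_ : \col_i _ = y) //; apply/colP => i; rewrite mxE cP.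
Qed.

End Genericity.

(** The matrices S and N act on column vectors, and v i generates the chains of
    group i of the refined diagram: they have length glen (pi i), where pi i is the
    group of the Young diagram, and the first r groups lie in ker S. *)
Section Chains.
Variables (k : fieldType) (n p g : nat) (pi : 'I_p -> 'I_g) (r : nat)
  (glen : 'I_g -> nat) (q : 'I_p -> nat).
Notation len i := (glen (pi i)).
Hypothesis E : (\sum_(i < p) \sum_(a < len i) q i)%N = n.
Hypothesis q0 : forall i, (0 < q i)%N.
Hypothesis glen0 : forall l, (0 < glen l)%N.
Hypothesis desc : forall i i' : 'I_p, (r <= i)%N -> (i <= i')%N -> (len i' <= len i)%N.
Hypothesis same : forall i i' : 'I_p, (r <= i)%N -> (r <= i')%N ->
  len i = len i' -> pi i = pi i'.

(** Column s of the matrix of the chains is the vector N^c S^b v_i where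
    chain_coords s = (i, (c, b)). *)
Definition block_coords (x : {i : 'I_p & 'I_(\sum_(a < len i) q i)}) :
    'I_p * (nat * nat) :=
  let y := tagnat.sig (tagged x) in (tag x, (nat_of_ord (tag y), nat_of_ord (tagged y))).
Definition chain_coords (s : 'I_n) :=
  block_coords (tagnat.sig (cast_ord (esym E) s)).
Definition chain_group s := (chain_coords s).1.
Definition chain_row s := (chain_coords s).2.1.
Definition chain_pos s := (chain_coords s).2.2.

Definition chain_index i (a : 'I_(len i)) (b : 'I_(q i)) : 'I_n :=
  cast_ord E (tagnat.Rank i (tagnat.Rank (p_ := fun=> q i) a b)).

Lemma chain_coords_index i (a : 'I_(len i)) (b : 'I_(q i)) :
  chain_coords (chain_index a b) = (i, (nat_of_ord a, nat_of_ord b)).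
Proof.
by rewrite /chain_coords /chain_index cast_ord_comp cast_ord_id /tagnat.Rank tagnat.rankK
   /block_coords /= tagnat.rankK.
Qed.

Variables (S N : 'M[k]_n).
Hypothesis SN : S *m N = N *m S.
Implicit Types (v : 'I_p -> 'cV[k]_n) (a : 'I_p -> nat -> k).

Definition chainmx v : 'M[k]_n := \matrix_(x, s)
  (iter (chain_row s) (mulmx N) (iter (chain_pos s) (mulmx S) (v (chain_group s)))) x 0.

(** The vectors v and the coefficients a give a normal form.  Every clause can be
    tested by rational expressions; that v i is in im S is ensured by the constant
    coefficient, and divisibility of the polynomials by their action. *)
Definition valid v a :=
  [/\ forall i, iter (len i) (mulmx N) (v i) = 0,
      forall i, pact (mulmx S) (gpoly (q i) (a i)) (v i) = 0,
      forall i : 'I_p, if (i < r)%N then S *m v i = 0 else a i 0%N != 0,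
      forall i i' : 'I_p, (i <= i')%N -> pi i = pi i' ->
        pact (mulmx S) (gpoly (q i) (a i)) (v i') = 0 &
      \det (chainmx v) != 0].

Lemma eq_valid v v' a a' : (forall i, v i = v' i) ->
  (forall i j, (j < q i)%N -> a i j = a' i j) -> valid v a -> valid v' a'.
Proof.
move=> vv aa; have gg i : gpoly (q i) (a' i) = gpoly (q i) (a i).
  by apply: eq_gpoly => j jq; rewrite aa.
case=> h1 h2 h3 h4 h5; split.
- by move=> i; rewrite -vv.
- by move=> i; rewrite -vv gg.
- by move=> i; have := h3 i; rewrite vv aa.
- by move=> i i' ii' e; rewrite -vv gg h4.
- by rewrite (_ : chainmx v' = chainmx v) //; apply/matrixP => x s; rewrite !mxE vv.
Qed.

Definition below t v (i : 'I_p) : 'cV[k]_n := if (i < t)%N then v i else 0.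

Lemma SNcomm (x : 'cV[k]_n) : S *m (N *m x) = N *m (S *m x).
Proof. by rewrite !mulmxA SN. Qed.

Lemma iterNS c b (x : 'cV[k]_n) :
  iter b (mulmx S) (iter c (mulmx N) x) = iter c (mulmx N) (iter b (mulmx S) x).
Proof.
elim: b => //= b ->; rewrite (iter_commute (f := mulmx S) (g := mulmx N)) //.
exact: SNcomm.
Qed.

Lemma pactN c d (x : 'cV[k]_n) :
  pact (mulmx S) d (iter c (mulmx N) x) = iter c (mulmx N) (pact (mulmx S) d x).
Proof. by rewrite pact_iter_commute // => y; rewrite /= SNcomm. Qed.

Lemma chain_comb v i c (d : {poly k}) (cl : (c < len i)%N) : (size d <= q i)%N ->
  pact (mulmx S) d (iter c (mulmx N) (v i)) =
  chainmx v *m (\sum_(b < q i) d`_b *: delta_mx (chain_index (Ordinal cl) b) 0).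
Proof.
move=> sd; rewrite (pactE _ _ sd) mulmx_sumr; apply: eq_bigr => b _.
rewrite -scalemxAr -colE iterNS; congr (_ *: _); apply/matrixP => x y.
by rewrite !mxE /chain_row /chain_pos /chain_group chain_coords_index ord1.
Qed.

Lemma chainmx_below t v (y : 'cV[k]_n) : chainmx (below t v) *m y =
  chainmx v *m (\col_s if (chain_group s < t)%N then y s 0 else 0).
Proof.
apply/matrixP => x z; rewrite !mxE; apply: eq_bigr => s _; rewrite !mxE ord1 /below.
case: ifP => // _; rewrite (iter_linear0 (mulmx S)) (iter_linear0 (mulmx N)).
by rewrite mxE mul0r mulr0.
Qed.

(** The columns of an invertible matrix are independent, so the span of the chains
    of the groups before t meets the chains of group i only in 0. *)
Lemma chain_independent v t (i : 'I_p) c (d : {poly k}) : \det (chainmx v) != 0 ->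
  (t <= i)%N -> (c < len i)%N -> (size d <= q i)%N ->
  colsp (chainmx (below t v)) (pact (mulmx S) d (iter c (mulmx N) (v i))) -> d = 0.
Proof.
move=> det0 ti cl sd [y]; rewrite (chain_comb _ cl sd) chainmx_below => E'.
have U : chainmx v \in unitmx by rewrite unitmxE unitfE.
have /(can_inj (mulKmx U)) Z := E'.
apply/polyP => b; rewrite coef0; have [bq|bq] := ltnP b (q i); last first.
  by rewrite nth_default // (leq_trans sd).
move/matrixP/(_ (chain_index (Ordinal cl) (Ordinal bq)) 0): Z; rewrite [RHS]mxE.
rewrite /chain_group chain_coords_index /= ltnNge ti /= summxE.
rewrite (bigD1 (Ordinal bq)) //= [X in _ + X]big1 ?addr0 => [|b' ne].
  by rewrite !mxE !eqxx mulr1.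
rewrite !mxE andbT; case: eqP => [E2|]; last by rewrite mulr0.
have := chain_coords_index (Ordinal cl) (Ordinal bq); rewrite E2 chain_coords_index.
by move=> /(congr1 (fun x => x.2.2)) /= e; case/eqP: ne; apply/val_inj.
Qed.

Lemma below_closed v a t (i : 'I_p) c (d : {poly k}) : valid v a -> (i < t)%N ->
  colsp (chainmx (below t v)) (pact (mulmx S) d (iter c (mulmx N) (v i))).
Proof.
case=> N0 P0 _ _ _ it; have [cl|lc] := ltnP c (len i); last first.
  rewrite -(subnK lc) iterD N0 (iter_linear0 (mulmx N)) linear0; exact: colsp0.
have pv : pact (mulmx S) (gpoly (q i) (a i)) (iter c (mulmx N) (v i)) = 0.
  by rewrite pactN P0 (iter_linear0 (mulmx N)).
rewrite (pact_modp pv); set d' := (d %% _)%R.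
have sd' : (size d' <= q i)%N := size_modp_ann (gpoly_monic _ _) (size_gpoly _ _) d.
have vE : v i = below t v i by rewrite /below it.
by rewrite vE (chain_comb _ cl sd'); eexists.
Qed.

(** Modulo the span of the chains before t, only groups in im S with chains that are
    at most as long as those of t remain.  Then N^(m-1), where m is the length for t,
    kills the shorter ones and the polynomial of t kills those of length m. *)
Lemma below_absorbs v a (t : 'I_p) (x : 'cV[k]_n) : valid v a -> (r <= t)%N ->
  colsp (chainmx (below t v))
    (pact (mulmx S) (gpoly (q t) (a t)) (iter (len t).-1 (mulmx N) (S *m x))).
Proof.
move=> va rt; have [N0 P0 S0 D0 det0] := va.
have U : chainmx v \in unitmx by rewrite unitmxE unitfE.
rewrite -[x](mulKVmx U); set y := invmx _ *m x.
have -> : chainmx v *m y = \sum_s y s 0 *: col s (chainmx v).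
  apply/matrixP => i j; rewrite mxE summxE ord1; apply: eq_bigr => s _.
  by rewrite !mxE mulrC.
rewrite mulmx_sumr (iter_linear_sum (mulmx N)) linear_sum; apply: colsp_sum => s _.
rewrite -scalemxAr (iter_linearZ (mulmx N)) linearZ_LR; apply: colspZ => /=.
have -> : col s (chainmx v) = iter (chain_row s) (mulmx N)
    (iter (chain_pos s) (mulmx S) (v (chain_group s))).
  by apply/matrixP => i j; rewrite !mxE ord1.
set i := chain_group s; set c := chain_row s; set b := chain_pos s.
have -> : S *m iter c (mulmx N) (iter b (mulmx S) (v i)) =
    iter c (mulmx N) (pact (mulmx S) 'X^(b.+1) (v i)).
  by rewrite pactXn (iter_commute (f := mulmx S) (g := mulmx N)) //; apply: SNcomm.
rewrite -iterD pactN -pactM.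
have [ir|ri] := ltnP i r.
  rewrite exprSr mulrA pactMX (pact_commute (f := mulmx S) (g := mulmx S)) //=.
  by have := S0 i; rewrite ir => ->; rewrite linear0 (iter_linear0 (mulmx N)); apply: colsp0.
have [it|ti] := ltnP i t; first by rewrite -pactN; apply: below_closed va it.
have := desc rt ti; rewrite leq_eqVlt => /orP[/eqP e|lt].
  have pit : pi t = pi i by apply: same.
  by rewrite mulrC pactM (D0 t i ti pit) linear0 (iter_linear0 (mulmx N)); apply: colsp0.
rewrite -pactN -(subnK (_ : len i <= (len t).-1 + c)%N).
  by rewrite iterD N0 (iter_linear0 (mulmx N)) linear0; apply: colsp0.
by have := glen0 (pi t); lia.
Qed.

(** The vector v t is in im S, so it is of the form S x; the difference of two such
    polynomials has smaller degree, and kills N^(m-1) v t modulo the span. *)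
Lemma absorbed_unique v a (t : 'I_p) (a' : nat -> k) : valid v a -> (r <= t)%N ->
  (forall x, colsp (chainmx (below t v))
    (pact (mulmx S) (gpoly (q t) a') (iter (len t).-1 (mulmx N) (S *m x)))) ->
  forall j, (j < q t)%N -> a' j = a t j.
Proof.
move=> [N0 P0 S0 D0 det0] rt ab j jq.
have := S0 t; rewrite ltnNge rt /= => a0.
have [u vu] := gpoly_invert (q0 t) a0 (P0 t).
have := ab u; rewrite -vu; set d := \poly_(j < q t) (a' j - a t j).
have -> : gpoly (q t) a' = gpoly (q t) (a t) + d.
  rewrite -addrA; congr (_ + _); apply/polyP => l; rewrite coefD !coef_poly.
  by case: ifP => _; rewrite ?addr0 // addrC subrK.
rewrite pactD {1}pactN P0 (iter_linear0 (mulmx N)) add0r.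
move/(chain_independent det0 (leqnn t)) => d0.
have := d0 _ (size_poly _ _); rewrite ltn_predL glen0 => /(_ isT) /polyP /(_ j).
by rewrite coef_poly jq coef0 => /eqP; rewrite subr_eq0 => /eqP.
Qed.

(** The map x |-> N^(m-1) S x, where m is the length of the chains of group t. *)
Definition shifted (t : 'I_p) : 'M[k]_n := iter (len t).-1 (mulmx N) S.

Lemma pact_mulmxl (d : {poly k}) (Z : 'M[k]_n) (x : 'cV[k]_n) :
  pact (mulmx S) d Z *m x = pact (mulmx S) d (Z *m x).
Proof.
rewrite /pact mulmx_suml; apply: eq_bigr => j _; rewrite -scalemxAl; congr (_ *: _).
by elim: (nat_of_ord j) => //= b IH; rewrite -mulmxA IH.
Qed.

Lemma iter_mulmxl c (X Z : 'M[k]_n) (x : 'cV[k]_n) :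
  iter c (mulmx X) Z *m x = iter c (mulmx X) (Z *m x).
Proof. by elim: c => //= c IH; rewrite -mulmxA IH. Qed.

(** The coefficients of the polynomial of group t solve a linear system whose
    entries are rational in the vectors of the earlier groups. *)
Lemma next_coefficients v a (t : 'I_p) Yg Bg (Y := chainmx (below t v))
    (M := fun j => mxvec ((1%:M - Y *m Yg) *m iter j (mulmx S) (shifted t)))
    (B := \matrix_(j < q t) M j) :
  valid v a -> (r <= t)%N -> Y *m Yg *m Y = Y -> B *m Bg *m B = B ->
  forall j : 'I_(q t), (- (M (q t) *m Bg)) 0 j = a t j.
Proof.
move=> va rt YY BB j.
have ME (c : nat -> k) : M (q t) + \sum_(j < q t) c j *: M j =
    mxvec ((1%:M - Y *m Yg) *m pact (mulmx S) (gpoly (q t) c) (shifted t)).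
  rewrite pact_gpoly mulmxDr linearD mulmx_sumr linear_sum; congr (_ + _).
  by apply: eq_bigr => l _; rewrite -scalemxAr linearZ_LR.
have rB (c : nat -> k) : (\row_(j < q t) c j) *m B = \sum_(j < q t) c j *: M j.
  by rewrite mulmx_sum_row; apply: eq_bigr => l _; rewrite mxE rowK.
have absorb (c : nat -> k) : (forall x, colsp Y (pact (mulmx S) (gpoly (q t) c)
    (iter (len t).-1 (mulmx N) (S *m x)))) <-> M (q t) + \sum_(j < q t) c j *: M j = 0.
  rewrite ME; split=> [h|/eqP h x].
    apply/eqP; rewrite mxvec_eq0; apply/eqP/matrixP => x0 s.
    set Z := _ *m _; suff: col s Z = 0 by move/matrixP/(_ x0 0); rewrite mxE => ->; rewrite !mxE.
    rewrite colE -mulmxA pact_mulmxl iter_mulmxl.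
    exact/(colsp_ginverse _ YY).
  apply/(colsp_ginverse _ YY); rewrite -iter_mulmxl -pact_mulmxl mulmxA.
  by move: h; rewrite mxvec_eq0 => /eqP ->; rewrite mul0mx.
set z := - _; pose c' l := oapp (fun j => z 0 j) 0 (insub l).
have c'z : (\row_(j < q t) c' j) = z by apply/rowP => l; rewrite mxE /c' valK.
rewrite (_ : z 0 j = c' j); last by rewrite /c' valK.
apply: (absorbed_unique va rt) (ltn_ord j); apply/absorb; rewrite -rB c'z.
have /absorb := fun x => below_absorbs x va rt; rewrite -rB => /eqP.
rewrite addr_eq0 => /eqP Mq.
by rewrite /z Mq !mulNmx opprK -!(mulmxA (\row__ _)) BB addNr.
Qed.

Definition update v (t : 'I_p) x i : 'cV[k]_n := if i == t then x else v i.

Lemma chainmx_update v t x c z : chainmx (update v t (x + c *: z)) =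
  chainmx (update v t x) + c *: chainmx (update (fun=> 0) t z).
Proof.
apply/matrixP => i s; rewrite !mxE /update; case: ifP => _.
  rewrite (iter_linearD (mulmx S)) (iter_linearZ (mulmx S)).
  by rewrite (iter_linearD (mulmx N)) (iter_linearZ (mulmx N)) !mxE.
by rewrite (iter_linear0 (mulmx S)) (iter_linear0 (mulmx N)) mxE mulr0 addr0.
Qed.

Definition generator_equations a (t : 'I_p) : 'M[k]_(n + n + n, n) :=
  col_mx (col_mx (iter (T := 'M[k]_n) (len t) (mulmx N) 1%:M)
                 (pact (U := 'M[k]_n) (mulmx S) (gpoly (q t) (a t)) 1%:M))
         (if (t < r)%N then S else 0 : 'M[k]_n).

Lemma generator_equationsP a (t : 'I_p) (x : 'cV[k]_n) : generator_equations a t *m x = 0 <->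
  [/\ iter (len t) (mulmx N) x = 0, pact (mulmx S) (gpoly (q t) (a t)) x = 0
     & (t < r)%N -> S *m x = 0].
Proof.
rewrite /generator_equations !mul_col_mx iter_mulmxl pact_mulmxl mul1mx; split.
  rewrite -!col_mx0 => /eq_col_mx[/eq_col_mx[-> ->] h]; split=> // tr.
  by rewrite tr in h.
move=> [-> -> h]; rewrite (_ : (if _ then S else 0) *m x = 0) ?col_mx0 //.
by case: ifP => [/h //|_]; rewrite mul0mx.
Qed.

(** A determinant that does not vanish at some solution of the equations for the
    generator of group t does not vanish at some small integral combination of
    the columns that span the solutions. *)
Lemma next_generator (char0 : [pchar k] =i pred0) v a (t : 'I_p) Lg
    (L := generator_equations a t) : valid v a -> L *m Lg *m L = L ->
  exists c : 'I_n -> 'I_n.+1,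
    valid (update v t ((1%:M - Lg *m L) *m \col_i (c i)%:R)) a.
Proof.
move=> [N0 P0 S0 D0 det0] LL; set K := 1%:M - _.
have LK : L *m K = 0 by rewrite mulmxBr mulmx1 mulmxA LL subrr.
have Lv : L *m v t = 0.
  by apply/generator_equationsP; split=> // tr; have := S0 t; rewrite tr.
have Kv : K *m v t = v t by rewrite mulmxBl mul1mx -mulmxA Lv mulmx0 subr0.
pose F y := chainmx (update v t (K *m y)).
pose G y := chainmx (update (fun=> 0) t (K *m y)).
have FG y c z : F (y + c *: z) = F y + c *: G z.
  by rewrite /F mulmxDr -scalemxAr chainmx_update.
have F0 : \det (F (v t)) != 0.
  rewrite /F Kv (_ : chainmx _ = chainmx v) //; apply/matrixP => i s.
  by rewrite !mxE /update; case: eqP => // ->.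
have [c dc] := integer_point char0 FG F0; exists c.
set x := K *m _; have : L *m x = 0 by rewrite mulmxA LK mul0mx.
move/generator_equationsP => [Nx Px Sx].
have ann i : pact (mulmx S) (gpoly (q i) (a i)) (v t) = 0 ->
    gpoly (q t) (a t) %| gpoly (q i) (a i).
  move=> piv; rewrite -(pact_eq0_dvd (gpoly_monic _ _) (size_gpoly _ _) (P0 t)).
    by rewrite piv.
  move=> d sd dv; apply: (chain_independent det0 (leq0n t) (glen0 (pi t)) sd).
  by rewrite /= dv; apply: colsp0.
split; rewrite // /update.
- by move=> i; case: eqP => [->|_].
- by move=> i; case: eqP => [->|_].
- move=> i; case: (i =P t) => [->|_]; last exact: S0.
  by have := S0 t; case: ifP => // tr _; apply: Sx.
- move=> i i' ii' e; case: eqP => [E'|_]; last exact: D0.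
  by apply: pact_dvd Px; apply: ann; rewrite -E'; apply: D0.
Qed.

End Chains.

(** * Stagewise guessing of the generators *)

Section RationalBlocks.
Variables (k : fieldType) (I : Type).
Local Notation E := (I -> k).

Lemma rational_mxvec m n (f : E -> 'M[k]_(m, n)) : rational_mx f ->
  rational_mx (fun env => mxvec (f env)).
Proof.
move=> rf i l; case/mxvec_indexP: l => x y.
by apply: eq_rational (rf x y) => env; rewrite ord1 mxvecE.
Qed.

Lemma rational_col_mx m1 m2 n (f : E -> 'M[k]_(m1, n)) (g : E -> 'M[k]_(m2, n)) :
  rational_mx f -> rational_mx g -> rational_mx (fun env => col_mx (f env) (g env)).
Proof.
move=> rf rg i j; case: (split_ordP i) => l ->.
  by apply: eq_rational (rf l j) => env; rewrite col_mxEu.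
by apply: eq_rational (rg l j) => env; rewrite col_mxEd.
Qed.

Lemma rational_pact_gpoly m n q (c : E -> nat -> k) (f : E -> 'M[k]_m)
    (g : E -> 'M[k]_(m, n)) : (forall j, rational (fun env => c env j)) ->
  rational_mx f -> rational_mx g ->
  rational_mx (fun env => pact (mulmx (f env)) (gpoly q (c env)) (g env)).
Proof.
move=> rc rf rg; apply: (@eq_rational_mx _ _ _ _ (fun env =>
  iter q (mulmx (f env)) (g env) +
  \sum_(j < q) c env j *: iter j (mulmx (f env)) (g env))).
  by move=> env; rewrite pact_gpoly.
apply: rational_mxD; first exact: rational_mx_iter.
by apply: rational_mx_sum => j; apply: rational_mxZ => //; apply: rational_mx_iter.
Qed.

End RationalBlocks.

Section Candidates.
Variables (k : fieldType) (char0 : [pchar k] =i pred0) (I : Type).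
Local Notation Env := (I -> k).
Variables (n p g : nat) (pi : 'I_p -> 'I_g) (r : nat) (glen : 'I_g -> nat) (q : 'I_p -> nat).
Notation len i := (glen (pi i)).
Hypothesis E : (\sum_(i < p) \sum_(a < len i) q i)%N = n.
Hypothesis q0 : forall i, (0 < q i)%N.
Hypothesis q1 : forall i : 'I_p, (i < r)%N -> q i = 1%N.
Hypothesis glen0 : forall l, (0 < glen l)%N.
Hypothesis desc : forall i i' : 'I_p, (r <= i)%N -> (i <= i')%N -> (len i' <= len i)%N.
Hypothesis same : forall i i' : 'I_p, (r <= i)%N -> (r <= i')%N ->
  len i = len i' -> pi i = pi i'.

Variables (S N : Env -> 'M[k]_n).
Hypotheses (rS : rational_mx S) (rN : rational_mx N).

Local Notation T := (('I_p -> 'cV[k]_n) * ('I_p -> nat -> k))%type.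
Definition rational_data (f : Env -> T) :=
  (forall i, rational_mx (fun env => (f env).1 i)) /\
  forall i j, rational (fun env => (f env).2 i j).

Local Notation ok env := (valid r E (S env) (N env)).

(** The choices already made for the groups before t, completed by others. *)
Definition merge U t (x x0 : 'I_p -> U) (i : 'I_p) := if (i < t)%N then x i else x0 i.

Lemma rational_chainmx (v : Env -> 'I_p -> 'cV[k]_n) :
  (forall i, rational_mx (fun env => v env i)) ->
  rational_mx (fun env => chainmx E (S env) (N env) (v env)).
Proof.
move=> rv x s; apply: (@eq_rational _ _ (fun env =>
  iter (chain_row E s) (mulmx (N env)) (iter (chain_pos E s) (mulmx (S env))
    (v env (chain_group E s))) x 0)); first by move=> env; rewrite mxE.
by apply: rational_mx_iter => //; apply: rational_mx_iter.
Qed.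

(** In ker S the only possible polynomial is X. *)
Lemma flagged_coefficient env v a (t : 'I_p) : ok env v a ->
  S env *m N env = N env *m S env -> (t < r)%N -> a t 0%N = 0.
Proof.
move=> [N0 P0 S0 D0 det0] SN tr; apply/eqP; apply: contraT => a0.
have := S0 t; rewrite tr => Sv; have := P0 t.
rewrite pact_gpoly (q1 tr) big_ord1 /= Sv add0r => /eqP.
rewrite scaler_eq0 (negPf a0) /= => /eqP v0.
have := chain_independent (E := E) SN det0 (leq0n t) (glen0 (pi t)) (d := 1).
rewrite size_poly1 q0 /= v0 linear0 => /(_ isT (colsp0 _)) /eqP.
by rewrite oner_eq0.
Qed.

Lemma guess_coefficients t (i0 : 'I_p) (f : Env -> T) : i0 = t :> nat -> rational_data f ->
  guess (fun c : Env -> nat -> k => forall j, rational (fun env => c env j))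
    (fun env c => S env *m N env = N env *m S env ->
      forall v a, ok env (merge t (f env).1 v) (merge t (f env).2 a) ->
        forall j, (j < q i0)%N -> c j = a i0 j).
Proof.
move=> i0t [rf1 rf2]; have [tr|rt] := ltnP i0 r.
  apply: (@guess_ret _ _ _ _ _ (fun _ _ => 0)) => [j|env SN v a va j].
    exact: rational0.
  rewrite (q1 tr); case: j => // _; have := flagged_coefficient va SN tr.
  by rewrite /merge i0t ltnn => ->.
pose Y env := chainmx E (S env) (N env) (below t (f env).1).
have rY : rational_mx Y.
  apply: rational_chainmx => i; rewrite /below; case: (i < t)%N => //.
  exact: rational_mx0.
apply: guess_bind (guess_ginverse rY) _ => Yg rYg.
pose M env j := mxvec ((1%:M - Y env *m Yg env) *m
  iter j (mulmx (S env)) (shifted pi glen (S env) (N env) i0)).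
have rM j : rational_mx (fun env => M env j).
  apply: rational_mxvec; apply: rational_mx_mul.
    apply: rational_mxD; first exact: rational_mx_scalar (rational1 _ _).
    by apply: rational_mxN; apply: rational_mx_mul.
  by apply: rational_mx_iter => //; apply: rational_mx_iter.
pose B env := \matrix_(j < q i0) M env j.
have rB : rational_mx B.
  by move=> x y; apply: eq_rational (rM x 0 y) => env; rewrite mxE.
apply: guess_bind (guess_ginverse rB) _ => Bg rBg.
pose c env j := oapp (fun j : 'I_(q i0) => (- (M env (q i0) *m Bg env)) 0 j) 0 (insub j).
apply: (@guess_ret _ _ _ _ _ c) => [j|env BB YY SN v a va j jq].
  rewrite /c; case: insub => [l|] /=; last exact: rational0.
  by apply: (@rational_mxN _ _ _ _ (fun env => M env (q i0) *m Bg env)); apply: rational_mx_mul.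
have := next_coefficients (Yg := Yg env) (Bg := Bg env) q0 glen0 desc same SN va rt.
have -> : chainmx E (S env) (N env) (below i0 (merge t (f env).1 v)) = Y env.
  apply/matrixP => x s; rewrite !mxE /below /merge i0t.
  by case: (_ < t)%N.
move=> /(_ YY BB (Ordinal jq)).
by rewrite /merge i0t ltnn /c insubT => <-.
Qed.

(** Every normal form can be changed, group after group, into one whose generators
    are rational in S and N. *)
Lemma guess_stage t : (t <= p)%N -> guess rational_data (fun env y =>
  S env *m N env = N env *m S env -> (exists v a, ok env v a) ->
  exists v a, ok env (merge t y.1 v) (merge t y.2 a)).
Proof.
elim: t => [|t IH] tp.
  apply: (@guess_ret _ _ _ _ _ (fun=> (fun=> 0, fun _ _ => 0))).
    by split=> [i|i j]; [exact: rational_mx0 | exact: rational0].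
  by move=> env _ [v [a va]]; exists v, a; apply: eq_valid va.
apply: guess_bind (IH (ltnW tp)) _ => f rf; have [rf1 rf2] := rf.
pose i0 := Ordinal tp.
apply: guess_bind (@guess_coefficients t i0 f erefl rf) _ => c rc.
pose L env := generator_equations pi r glen q (S env) (N env) (fun=> c env) i0.
have rL : rational_mx L.
  have r1 : rational_mx (fun _ : Env => 1%:M : 'M[k]_n).
    exact: rational_mx_scalar (rational1 _ _).
  apply: rational_col_mx.
    apply: rational_col_mx; first exact: rational_mx_iter.
    exact: rational_pact_gpoly.
  by case: (_ < r)%N => //; apply: rational_mx0.
apply: guess_bind (guess_ginverse rL) _ => Lg rLg.
pose x (z : {ffun 'I_n -> 'I_n.+1}) env : 'cV[k]_n :=
  (1%:M - Lg env *m L env) *m \col_i (z i)%:R.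
pose F z env : T := (update (f env).1 i0 (x z env),
  fun i => if i == i0 then c env else (f env).2 i).
apply: (@guess_union _ _ _ _ _ (fun z env y => y = F z env)).
  move=> z; apply: (@guess_ret _ _ _ _ _ (F z)) => //; split=> [i|i j] /=.
    rewrite /update; case: eqP => _ //; apply: rational_mx_mul.
      apply: rational_mxD; first exact: rational_mx_scalar (rational1 _ _).
      by apply: rational_mxN; apply: rational_mx_mul.
    by move=> a b; apply: eq_rational (rational_nat _ _ (z a)) => env; rewrite mxE.
  by case: eqP.
move=> env; case: (Classical_Prop.classic (S env *m N env = N env *m S env /\
   exists v a, ok env (merge t (f env).1 v) (merge t (f env).2 a))); last first.
  move=> no; exists [ffun=> ord0] => y _ _ _ h SN ex; case: no; split=> //.
  exact: h.
move=> [SN [v [a va]]].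
case: (Classical_Prop.classic (L env *m Lg env *m L env = L env)) => [LL|no]; last first.
  by exists [ffun=> ord0] => y _ /no.
case: (Classical_Prop.classic (forall j, (j < q i0)%N -> c env j = a i0 j)) => [ca|no]; last first.
  by exists [ffun=> ord0] => y _ _ /(_ SN v a va).
have cE : L env = generator_equations pi r glen q (S env) (N env) (merge t (f env).2 a) i0.
  rewrite /L /generator_equations; congr (col_mx (col_mx _ (pact _ _ _)) _).
  by apply: eq_gpoly => j jq; rewrite /merge ltnn ca.
have := next_generator (Lg := Lg env) glen0 SN char0 va (t := i0).
rewrite -cE => /(_ LL) [z zP]; exists (finfun z) => y -> _ _ _ _ _.
have ltS (i : 'I_p) : (i < t.+1)%N = (i == i0) || (i < t)%N by rewrite ltnS leq_eqVlt.
exists v, a; apply: (eq_valid q0 _ _ zP) => [i|i j jq].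
  rewrite /F /= /update /merge ltS; case: eqP => [e|_] //=.
  by rewrite /x; congr (_ *m _); apply/colP => b; rewrite !mxE ffunE.
rewrite /F /= /merge ltS; case: eqP => [e|_] //=.
by rewrite e ltnn ca // -e.
Qed.

Lemma guess_valid : guess rational_data (fun env y =>
  S env *m N env = N env *m S env -> (exists v a, ok env v a) -> ok env y.1 y.2).
Proof.
apply: guess_sub (guess_stage (leqnn p)) => env y h SN /(h SN)[v [a va]].
by apply: (eq_valid q0 _ _ va) => [i|i j _]; rewrite /merge ltn_ord.
Qed.

Definition validb (S0 N0 : 'M[k]_n) (y : T) :=
  [&& [forall i, iter (len i) (mulmx N0) (y.1 i) == 0],
      [forall i, pact (mulmx S0) (gpoly (q i) (y.2 i)) (y.1 i) == 0],
      [forall i : 'I_p, if (i < r)%N then S0 *m y.1 i == 0 else y.2 i 0%N != 0],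
      [forall i : 'I_p, forall i' : 'I_p, ((i <= i')%N && (pi i == pi i')) ==>
        (pact (mulmx S0) (gpoly (q i) (y.2 i)) (y.1 i') == 0)] &
      \det (chainmx E S0 N0 y.1) != 0].

Lemma validP S0 N0 y : reflect (valid r E S0 N0 y.1 y.2) (validb S0 N0 y).
Proof.
apply: (iffP and5P) => -[h1 h2 h3 h4 h5]; split=> //.
- by move=> i; apply/eqP; have/forallP := h1.
- by move=> i; apply/eqP; have/forallP := h2.
- by move=> i; have/forallP/(_ i) := h3; case: ifP => // _ /eqP.
- move=> i i' ii' e; have/forallP/(_ i)/forallP/(_ i') := h4.
  by rewrite ii' e eqxx => /eqP.
- by apply/forallP => i; apply/eqP.
- by apply/forallP => i; apply/eqP.
- by apply/forallP => i; have := h3 i; case: ifP => // _ ->.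
- apply/forallP => i; apply/forallP => i'; apply/implyP => /andP[ii' /eqP e].
  exact/eqP/h4.
Qed.

Lemma testable_valid f : rational_data f ->
  testable (fun env => validb (S env) (N env) (f env)).
Proof.
move=> [rf1 rf2]; repeat apply: testable_and.
- by apply: testable_forall => i; apply: testable_mx_eq0; apply: rational_mx_iter.
- by apply: testable_forall => i; apply: testable_mx_eq0; apply: rational_pact_gpoly.
- apply: testable_forall => i; case: (_ < r)%N.
    by apply: testable_mx_eq0; apply: rational_mx_mul.
  by apply: testableN; apply: testable_eq0.
- apply: testable_forall => i; apply: testable_forall => i'.
  case: (_ && _); last exact: testable_const.
  by apply: testable_mx_eq0; apply: rational_pact_gpoly.
- by apply: testableN; apply: testable_eq0; apply: rational_det; apply: rational_chainmx.
Qed.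

End Candidates.

(** * From tested generators to normal forms *)

Section Coordinates.
Variables (k : fieldType) (V : vectType k) (n : nat) (e : n.-tuple V).
Hypothesis be : basis_of fullv e.

Definition vec (x : 'cV[k]_n) : V := \sum_j x j 0 *: tnth e j.

Lemma vec_linear : linear vec.
Proof.
move=> a x y; rewrite /vec scaler_sumr -big_split /=; apply: eq_bigr => j _.
by rewrite !mxE scalerDl scalerA.
Qed.

HB.instance Definition _ := GRing.isLinear.Build k 'cV[k]_n V *:%R vec vec_linear.

Lemma coord_vec x i : coord e i (vec x) = x i 0.
Proof.
rewrite /vec; under eq_bigr do rewrite (tnth_nth 0).
by rewrite coord_sum_free ?(basis_free be).
Qed.

Lemma vec_coord v : vec (\col_i coord e i v) = v.
Proof.
rewrite [RHS](coord_basis be (memvf v)); apply: eq_bigr => j _.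
by rewrite mxE (tnth_nth 0).
Qed.

Lemma vec_inj x y : vec x = vec y -> x = y.
Proof. by move=> xy; apply/colP => i; rewrite -!coord_vec xy. Qed.

Lemma vec_mulmx (f : 'End(V)) x : vec (matrix_of e f *m x) = f (vec x).
Proof.
have st : stable f fullv by apply: subvf.
rewrite /vec linear_sum; under [RHS]eq_bigr do
  rewrite linearZ_LR /= (matrix_of_sum _ be st) scaler_sumr.
rewrite exchange_big; apply: eq_bigr => i _ /=; rewrite mxE scaler_suml.
by apply: eq_bigr => j _; rewrite scalerA mulrC.
Qed.

Lemma vec_iter (f : 'End(V)) c x :
  vec (iter c (mulmx (matrix_of e f)) x) = iter c f (vec x).
Proof. by elim: c => //= c <-; rewrite vec_mulmx. Qed.

Lemma vec_pact (f : 'End(V)) d x :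
  vec (pact (mulmx (matrix_of e f)) d x) = pact f d (vec x).
Proof.
by rewrite /pact linear_sum; apply: eq_bigr => j _; rewrite linearZ_LR /= vec_iter.
Qed.

Lemma matrix_of_comm (f h : 'End(V)) : (forall v, f (h v) = h (f v)) ->
  matrix_of e f *m matrix_of e h = matrix_of e h *m matrix_of e f.
Proof.
move=> fh; apply/matrixP => i j.
suff : (matrix_of e f *m matrix_of e h) *m (delta_mx j 0 : 'cV_n) =
       (matrix_of e h *m matrix_of e f) *m delta_mx j 0.
  by rewrite -!colE => /matrixP/(_ i 0); rewrite [LHS]mxE [RHS]mxE.
by apply: vec_inj; rewrite -!mulmxA !vec_mulmx.
Qed.

Lemma change_basis n' (E : n' = n) (c : n'.-tuple V) f
    (P : 'M[k]_n := \matrix_(x, s) coord e x (tnth c (cast_ord (esym E) s))) :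
  \det P != 0 -> basis_of fullv c /\
    castmx (E, E) (matrix_of c f) = invmx P *m matrix_of e f *m P.
Proof.
move: c @P; case: n / E e be => e' be' c P detP.
have U : P \in unitmx by rewrite unitmxE unitfE.
have PE : P = coordmx e' c by apply/matrixP => x s; rewrite !mxE cast_ord_id.
have bc : basis_of fullv c.
  rewrite basisEfree subvf (size_basis be') size_tuple leqnn !andbT.
  apply/freeP => a a0 j; pose x := \col_s a s.
  suff : P *m x = 0.
    by move/(congr1 (mulmx (invmx P))); rewrite mulKmx // mulmx0 => /colP/(_ j); rewrite !mxE.
  apply/colP => i; rewrite !mxE -[RHS](linear0 (coord e' i)) -a0 linear_sum.
  by apply: eq_bigr => s _; rewrite linearZ /= !mxE cast_ord_id mulrC (tnth_nth 0).
split=> //; rewrite castmx_id -mulmxA PE (coordmx_conj be' bc (subvf _)) -PE.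
by rewrite mulKmx.
Qed.

End Coordinates.

(** The discrete part of a normal form.  The group i of the refined diagram has q i
    chains and lies over the group pi i, of length glen (pi i), of the Young diagram;
    r and rG are the numbers of groups in ker S. *)
Record form_shape n p g (pi : 'I_p -> 'I_g) (r rG : nat) (glen : 'I_g -> nat)
    (q : 'I_p -> nat) : Prop := FormShape {
  sh_dim : (\sum_(i < p) \sum_(a < glen (pi i)) q i)%N = n;
  sh_q : forall i, (0 < q i)%N;
  sh_len : forall l, (0 < glen l)%N;
  sh_ker1 : forall i : 'I_p, (i < r)%N -> q i = 1%N;
  sh_desc : forall i i' : 'I_p, (r <= i)%N -> (i <= i')%N ->
    (glen (pi i') <= glen (pi i))%N;
  sh_r : (r <= p)%N;
  sh_rG : (rG <= g)%N;
  sh_flag : forall i : 'I_p, (i < r)%N = (pi i < rG)%N;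
  sh_mono : forall i i' : 'I_p, (i <= i')%N -> (pi i <= pi i')%N;
  sh_onto : forall l, exists i, pi i = l;
  sh_young : forall l l' : 'I_g, (l < rG)%N = (l' < rG)%N -> glen l = glen l' -> l = l' }.

Lemma shape_same n p g (pi : 'I_p -> 'I_g) r rG glen q :
  form_shape n pi r rG glen q -> forall i i' : 'I_p, (r <= i)%N -> (r <= i')%N ->
  glen (pi i) = glen (pi i') -> pi i = pi i'.
Proof.
move=> sh i i' ri ri'; apply: (sh_young sh).
by rewrite -!(sh_flag sh) !ltnNge ri ri'.
Qed.

Section Soundness.
Variables (k : fieldType) (V : vectType k) (A S N : 'End(V)).
Hypothesis jd : jordan_decomposition A S N.
Variables (n : nat) (e : n.-tuple V).
Hypothesis be : basis_of fullv e.

Let ss : semisimple S. Proof. by have [] := jd. Qed.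
Let SN v : S (N v) = N (S v).
Proof. by have [_ /lfunP/(_ v)] := jd; rewrite !comp_lfunE. Qed.

(** The generating spaces of the Young diagram are recovered as the sums of the cyclic
    spaces that lie over them; both diagrams are bases by counting. *)
Lemma valid_normal_form p g (pi : 'I_p -> 'I_g) r rG glen q
    (sh : form_shape n pi r rG glen q) v a
    (P := chainmx (sh_dim sh) (matrix_of e S) (matrix_of e N) v) :
  valid r (sh_dim sh) (matrix_of e S) (matrix_of e N) v a ->
  uniform_normal_form S N (invmx P *m matrix_of e A *m P).
Proof.
move=> [N0 P0 S0 D0 det0].
pose W i := vec e (v i); pose Q i := gpoly (q i) (a i).
have NW i : iter (glen (pi i)) N (W i) = 0.
  by rewrite -(vec_iter be) N0 linear0.
have QW i : pact S (Q i) (W i) = 0 by rewrite -(vec_pact be) P0 linear0.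
have DW (i i' : 'I_p) : (i <= i')%N -> pi i = pi i' -> pact S (Q i) (W i') = 0.
  by move=> ii' eq; rewrite -(vec_pact be) D0 ?linear0.
have SW i : W i \in if (i < r)%N then lker S else limg S.
  have := S0 i; case: ifP => _ h.
    by rewrite memv_ker -(vec_mulmx be) h linear0.
  have [u ->] := gpoly_invert (f := S) (sh_q sh i) h (QW i).
  by rewrite memv_img ?memvf.
pose H := krylov_generators S r (fun i => glen (pi i)) q W.
have cH x s : coord e x (tnth (all_chains N H) (cast_ord (esym (sh_dim sh)) s)) = P x s.
  by rewrite !tnth_mktuple mxE -(coord_vec be) !(vec_iter be).
have [bH matH] : basis_of fullv (all_chains N H) /\
    castmx (sh_dim sh, sh_dim sh) (matrix_of (all_chains N H) A) =
      invmx P *m matrix_of e A *m P.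
  pose P' := \matrix_(x, s) coord e x (tnth (all_chains N H) (cast_ord (esym (sh_dim sh)) s)).
  have PP' : P' = P by apply/matrixP => x s; rewrite mxE cH.
  by rewrite -PP'; apply: change_basis => //; rewrite -/P' PP'.
have fH := basis_free bH.
have dV : \dim {:V} = n by rewrite (size_basis be).
have frk i : free (krylov S (q i) (W i)).
  by have := gen_free fH (l := i); apply; apply: (sh_len sh).
have Qm i : Q i \is monic by apply: gpoly_monic.
have Qs i : size (Q i) = (q i).+1 by apply: size_gpoly.
have stk i : stable S <<krylov S (q i) (W i)>>%VS by apply: krylov_stable (QW i).
pose F l := (\sum_(i | pi i == l) <<krylov S (q i) (W i)>>)%VS.
have dF l : (\dim (F l) <= \sum_(i | pi i == l) q i)%N.
  apply: leq_trans (dimv_leq_sum _ _ _) _; apply: leq_sum => i _.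
  exact: dim_krylov_le.
pose G := Generators rG glen (fun l => vbasis (F l)).
have gE (l : 'I_(ngroups G)) : gen_space l = F l by apply: (span_basis (vbasisP _)).
have WF i : W i \in F (pi i).
  have : (<<krylov S (q i) (W i)>> <= F (pi i))%VS by rewrite /F (sumv_sup i).
  by move/subvP; apply; apply: krylov_mem; apply: (sh_q sh).
have nq : (\sum_l glen l * \sum_(i | pi i == l) q i)%N = n.
  rewrite -(sh_dim sh) [RHS](partition_big pi predT) //=; apply: eq_bigr => l _.
  by rewrite big_distrr /=; apply: eq_bigr => i /eqP ->; rewrite sum_nat_const card_ord.
have Fsub l (C : {vspace V}) :
    (forall i, pi i = l -> forall d, pact S d (W i) \in C) -> (F l <= C)%VS.
  move=> h; apply/subv_sumP => i /eqP il; apply/subvP => w /krylov_spanP[d _ ->].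
  exact: h.
have stF l : stable S (F l) by apply: stable_sum.
have jG : jordan_bases S N G.
  apply: jordan_bases_count => //.
  - exact: (sh_rG sh).
  - move=> l; split; first exact: (sh_len sh).
    + rewrite /= lt0n dimv_eq0; have [i il] := sh_onto sh l.
      apply: contraTneq (WF i) => F0; rewrite il F0 memv0.
      have := frk i => /(free_not0 (v := W i)); apply.
      by rewrite krylovE; apply/mapP; exists 0%N; rewrite // mem_iota (sh_q sh).
    + move=> w; rewrite gE => wF.
      have : (F l <= lker (linfun (iterl N (glen l))))%VS.
        apply: Fsub => i il d; rewrite memv_ker lfunE /= /iterl.
        have NWl : iter (glen l) N (W i) = 0 by rewrite -il.
        by rewrite (pact_iter_commute (f := S) (g := N)) ?NWl ?linear0 // => u /=.
      by move/subvP/(_ w wF); rewrite memv_ker lfunE => /eqP.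
  - move=> l; rewrite gE /=; apply: Fsub => i il d.
    have := SW i; rewrite (sh_flag sh) il; case: ifP => _.
      by apply: stable_pact; apply: stable_lker_commute.
    by apply: stable_pact; apply: stable_limg_commute => //; apply: subvf.
  - apply/eqP; rewrite eqEsubv subvf -(span_basis bH) span_all_chains; apply/subv_sumP => i _.
    rewrite chain_spaceE; apply: (sumv_sup (pi i)) => //.
    apply/subv_sumP => j _; rewrite (sumv_sup j) // gE !iter_limgE limgS //.
    by rewrite /F (sumv_sup i).
  - rewrite dV -[leqRHS]nq; apply: leq_sum => l _; rewrite leq_mul2l.
    by apply/orP; right; apply: dF.
have dFE l : \dim (F l) = (\sum_(i | pi i == l) q i)%N.
  have fG := basis_free (jordan_full ss jG).
  have tot : (\sum_l glen l * \dim (F l) = n)%N.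
    rewrite -dV -(span_basis (jordan_full ss jG)) (eqP fG) size_tuple.
    by apply: eq_bigr => l' _; rewrite sum_nat_const card_ord.
  apply/eqP; rewrite -(eqn_pmul2l (sh_len sh l)); apply/eqP.
  apply: (@sum_leq_eq _ predT (fun l => glen l * \dim (F l))%N
     (fun l => glen l * \sum_(i | pi i == l) q i)%N) => //.
  - by move=> l' _; rewrite leq_mul2l; apply/orP; right; apply: dF.
  - by rewrite nq tot.
have rd : refining_data S (G := G) pi r q W Q.
  split=> //.
  - exact: (sh_r sh).
  - exact: (sh_flag sh).
  - exact: (sh_mono sh).
  - exact: (sh_q sh).
  - move=> i i' ii' eq; rewrite -(ann_dvd (Qm i') (Qs i') (QW i')) // DW //.
  - by move=> l; rewrite gE dFE.
have [refH compH] := refining_data_refines ss SN jG rd.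
have [jH _ _ _ [stH _]] := refH.
have [_ _ [_ mH]] := refined_normal_form jd jH compH stH.
exists G, H, pi, (sh_dim sh); split=> //.
- by split=> // l l'; apply: (sh_young sh).
- by move=> l; rewrite gE.
- by rewrite -matH mH.
Qed.

End Soundness.

(** * The algorithm *)

Lemma det_coordmx (k : fieldType) (V : vectType k) n n' (E : n' = n) (e : n.-tuple V)
    (c : n'.-tuple V) : basis_of fullv e -> basis_of fullv c ->
  \det (\matrix_(x < n, s < n) coord e x (tnth c (cast_ord (esym E) s))) != 0.
Proof.
case: n / E e => e be bc; rewrite -unitfE -unitmxE.
have [U _] := mulmx1_unit (coordmxK be bc); set M := (X in X \in _).
suff -> : M = coordmx e c by [].
by apply/matrixP => x s; rewrite !mxE cast_ord_id.
Qed.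

Definition admissible (k : fieldType) n p g (pi : 'I_p -> 'I_g) r rG glen q
    (Sm Nm : 'M[k]_n) :=
  exists (sh : form_shape n pi r rG glen q) v a, valid r (sh_dim sh) Sm Nm v a.

Section Existence.
Variables (k : fieldType) (V : vectType k) (A S N : 'End(V)).
Hypothesis jd : jordan_decomposition A S N.
Variables (n : nat) (e : n.-tuple V).
Hypothesis be : basis_of fullv e.

Let ss : semisimple S. Proof. by have [] := jd. Qed.
Let SN v : S (N v) = N (S v).
Proof. by have [_ /lfunP/(_ v)] := jd; rewrite !comp_lfunE. Qed.

Lemma admissible_exists : exists p g (pi : 'I_p -> 'I_g) r rG glen q,
  admissible pi r rG glen q (matrix_of e S) (matrix_of e N).
Proof.
have [G [[jG yG] stG descG]] := young_bases_exist jd.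
have nkG : (nker G <= ngroups G)%N by case: jG.
have [p [pi [r [q [W [P rd]]]]]] := refining_data_exists ss stG nkG.
have [[jH _ _ _ _] _] := refining_data_refines ss SN jG rd.
case: rd => nk flag mono q0 Pm Ps Pv Pd Psum Pdim.
pose H := krylov_generators S r (fun i => len (pi i)) q W.
have bH : basis_of fullv (all_chains N H) := jordan_full ss jH.
have fH := basis_free bH.
have lG (l : 'I_(ngroups G)) : (0 < len l)%N := jordan_len0 l jG.
have frk i : free (krylov S (q i) (W i)).
  by have := gen_free fH (l := i); apply; apply: lG.
have WH i : W i \in gen_space (G := H) i by apply: krylov_mem.
have kerW (i : 'I_p) : (i < r)%N -> S (W i) = 0.
  move=> ir; apply/eqP; rewrite -memv_ker.
  exact: (subvP (@jordan_gen_ker _ _ S N H i jH ir)).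
have limW (i : 'I_p) : ~~ (i < r)%N -> W i \in limg S.
  by move=> ir; apply: (subvP (@jordan_gen_limg _ _ S N H i jH ir)).
have dimE : (\sum_(i < p) \sum_(a < len (pi i)) q i)%N = n.
  by rewrite -(size_basis bH) (size_basis be).
have ker1 (i : 'I_p) : (i < r)%N -> q i = 1%N.
  move=> /kerW SW; apply/eqP; rewrite eqn_leq q0 andbT leqNgt.
  apply/negP => q2; have := krylov_free_eq0 (frk i) (p := 'X).
  rewrite size_polyX -['X]expr1 pactXn /= => /(_ q2 SW)/eqP.
  by rewrite expr1 polyX_eq0.
have sh : form_shape n pi r (nker G) (@len _ _ G) q.
  split=> //.
  - move=> i i' ri ii'; apply: descG; last exact: mono.
    by rewrite leqNgt -flag -leqNgt.
  - move=> l; case: (pickP (fun i => pi i == l)) => [i /eqP|no]; first by exists i.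
    have := Pdim l; rewrite big_pred0 // /gen_space.
    have /eqP -> := gen_free (basis_free (jordan_full ss jG)) (lG l).
    by rewrite size_tuple; case: jG => _ /(_ l); case: (nvec l).
exists p, (ngroups G), pi, r, (nker G), (@len _ _ G), q, sh.
pose v i : 'cV[k]_n := \col_x coord e x (W i); pose a i j := (P i)`_j.
have vW i : vec e (v i) = W i by apply: vec_coord.
have gP i : gpoly (q i) (a i) = P i by apply: gpolyK.
exists v, a; split.
- move=> i; apply: (vec_inj be); rewrite (vec_iter be) vW linear0.
  exact: (gen_iter_len jH (WH i)).
- by move=> i; apply: (vec_inj be); rewrite gP (vec_pact be) vW linear0.
- move=> i; case: ifP => ir.
    by apply: (vec_inj be); rewrite (vec_mulmx be) vW linear0 kerW.
  rewrite /a; apply/negP; rewrite -horner_coef0 => /factor_theorem[d].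
  rewrite polyC0 subr0 => PE; have d0 : d != 0.
    by apply: contraTneq (monic_neq0 (Pm i)) => d0; rewrite PE d0 mul0r eqxx.
  have sd : (size d <= q i)%N by have := Ps i; rewrite PE size_mulX // => -[->].
  case/eqP: d0; apply: (krylov_free_eq0 (frk i) sd).
  have [dKI _] := semisimple_ker_limg ss; apply/eqP; rewrite -memv0 -dKI memv_cap.
  rewrite memv_ker -pactMX -PE Pv eqxx /=; apply: stable_pact.
    by apply: stable_limg_commute => //; apply: subvf.
  by apply: limW; rewrite ir.
- move=> i i' ii' pii; apply: (vec_inj be); rewrite gP (vec_pact be) vW linear0.
  by apply: pact_dvd (Pv i'); apply: Pd.
have := det_coordmx (sh_dim sh) be bH.
set M1 := (X in \det X != 0) => det1; set M2 := chainmx _ _ _ _.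
suff -> : M2 = M1 by [].
apply/matrixP => x s; rewrite !mxE !tnth_mktuple -(coord_vec be) !(vec_iter be) vW.
by [].
Qed.

End Existence.

Section Algorithm.
Variables (k : fieldType) (char0 : [pchar k] =i pred0) (n : nat).

Local Notation I := ('I_n * 'I_n + 'I_n * 'I_n)%type.
Local Notation Env := (I -> k).

Definition input1 (env : Env) : 'M[k]_n := \matrix_(i, j) env (inl (i, j)).
Definition input2 (env : Env) : 'M[k]_n := \matrix_(i, j) env (inr (i, j)).

Lemma rational_input1 : rational_mx input1.
Proof. by move=> i j; apply: eq_rational (rational_var _ _) => env; rewrite mxE. Qed.

Lemma rational_input2 : rational_mx input2.
Proof. by move=> i j; apply: eq_rational (rational_var _ _) => env; rewrite mxE. Qed.

Definition correct_output (b : Env -> bool) (X : 'M[field_expr I]_n) :=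
  forall (V : vectType k) (A S N : 'End(V)) (e : n.-tuple V) env,
    jordan_decomposition A S N -> basis_of fullv e ->
    matrix_of e S = input1 env -> matrix_of e N = input2 env -> b env ->
    uniform_normal_form S N (map_mx (feval env) X).

(** Finitely many outputs, guarded by tests, one of which passes its test whenever Q
    holds. *)
Definition tested_outputs (Q : Env -> Prop) :=
  exists (C : finType) (b : C -> Env -> bool) (X : C -> 'M[field_expr I]_n),
    [/\ forall c, testable (b c), forall c, correct_output (b c) (X c) &
        forall env, Q env -> exists c, b c env].

Lemma shape_outputs p g (pi : 'I_p -> 'I_g) r rG glen q :
  tested_outputs (fun env => input1 env *m input2 env = input2 env *m input1 env /\
    admissible pi r rG glen q (input1 env) (input2 env)).
Proof.
case: (Classical_Prop.classic (form_shape n pi r rG glen q)) => [sh|no]; last first.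
  exists void, (fun _ _ => false), (fun=> const_mx FZero); split=> //.
  by move=> env [_ [sh _]].
have [C [F [rF FP]]] := @guess_valid k char0 I n p g pi r glen q (sh_dim sh) (sh_q sh)
  (sh_ker1 sh) (sh_len sh) (sh_desc sh) (shape_same sh) _ _ rational_input1 rational_input2.
pose P c env := chainmx (sh_dim sh) (input1 env) (input2 env) (F c env).1.
(* The inverse of P by its adjugate, so that it is rational at every point. *)
pose D c env := (\det (P c env))^-1 *: \adj (P c env) *m (input1 env + input2 env) *m P c env.
have rD c : rational_mx (D c).
  have rP : rational_mx (P c).
    by apply: rational_chainmx; [exact: rational_input1|exact: rational_input2|exact: (rF c).1].
  apply: rational_mx_mul => //; apply: rational_mx_mul.
    by apply: rational_mxZ; [apply/rationalV/rational_det|apply: rational_adj].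
  by apply: rational_mxD; [exact: rational_input1|exact: rational_input2].
have [X XP] := functional_choice _ (fun c => rational_mx_expr (rD c)).
exists C, (fun c env => validb r (sh_dim sh) (input1 env) (input2 env) (F c env)), X.
split.
- by move=> c; apply: testable_valid; [exact: rational_input1|exact: rational_input2|].
- move=> c V A S N e env jd be Se Ne /validP va.
  rewrite -XP; have [_ _ _ _ det0] := va; rewrite -Se -Ne in va.
  have := valid_normal_form jd be va.
  have -> : matrix_of e A = input1 env + input2 env.
    have [-> _ _ _] := jd; rewrite -Se -Ne; apply/matrixP => x y.
    by rewrite !mxE add_lfunE linearD.
  rewrite Se Ne -/(P c env) /invmx; have -> : P c env \in unitmx.
    by rewrite unitmxE unitfE.
  by [].
- move=> env [SN [sh' [v [a va]]]]; have [c cP] := FP env; exists c.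
  apply/validP; apply: cP => //; exists v, a.
  by rewrite (eq_irrelevance (sh_dim sh) (sh_dim sh')).
Qed.

(** A shape consists of numbers at most n and of maps between finite sets of at
    most n elements, so there are finitely many. *)
Definition shape_code : finType :=
  {pg : 'I_n.+1 * 'I_n.+1 &
    ('I_n.+1 * 'I_n.+1 * {ffun 'I_pg.1 -> 'I_pg.2} * {ffun 'I_pg.2 -> 'I_n.+1}
      * {ffun 'I_pg.1 -> 'I_n.+1})%type}.

Definition coded_admissible (c : shape_code) (Sm Nm : 'M[k]_n) :=
  let: (r, rG, pi, glen, q) := tagged c in
  admissible (fun i => pi i) r rG (fun l => nat_of_ord (glen l)) (fun i => nat_of_ord (q i)) Sm Nm.

(** All the numbers of an admissible shape are at most n because the sum of the
    glen (pi i) * q i is n. *)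
Lemma admissible_coded p g (pi : 'I_p -> 'I_g) r rG glen q Sm Nm :
  admissible pi r rG glen q Sm Nm -> exists c, coded_admissible c Sm Nm.
Proof.
move=> adm; have [sh _] := adm.
have qlen i : (q i <= glen (pi i) * q i)%N.
  by rewrite leq_pmull // (sh_len sh).
have tot : (\sum_i glen (pi i) * q i)%N = n.
  by rewrite -(sh_dim sh); apply: eq_bigr => i _; rewrite sum_nat_const card_ord.
have one i : (glen (pi i) * q i <= n)%N by rewrite -tot (bigD1 i) //= leq_addr.
have pn : (p < n.+1)%N.
  rewrite ltnS -tot; apply: leq_trans (_ : \sum_(i < p) 1 <= _)%N.
    by rewrite sum1_card card_ord.
  apply: leq_sum => i _.
  by rewrite muln_gt0 (sh_len sh) (sh_q sh).
have gp : (g <= p)%N.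
  have [f fP] := functional_choice _ (sh_onto sh).
  have fi : injective f by move=> l l' ff; rewrite -(fP l) -(fP l') ff.
  by have := leq_card f fi; rewrite !card_ord.
have gn : (g < n.+1)%N := leq_ltn_trans gp pn.
have rn : (r < n.+1)%N := leq_ltn_trans (sh_r sh) pn.
have rGn : (rG < n.+1)%N := leq_ltn_trans (sh_rG sh) gn.
have glenn l : (glen l < n.+1)%N.
  have [i <-] := sh_onto sh l; rewrite ltnS; apply: leq_trans (one i).
  by rewrite leq_pmulr // (sh_q sh).
have qn i : (q i < n.+1)%N by rewrite ltnS; apply: leq_trans (one i).
pose c : shape_code := Tagged (fun pg : 'I_n.+1 * 'I_n.+1 =>
    ('I_n.+1 * 'I_n.+1 * {ffun 'I_pg.1 -> 'I_pg.2} * {ffun 'I_pg.2 -> 'I_n.+1}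
      * {ffun 'I_pg.1 -> 'I_n.+1})%type)
  (i := (Ordinal pn, Ordinal gn))
  (Ordinal rn, Ordinal rGn, finfun pi, [ffun l => Ordinal (glenn l)], [ffun i => Ordinal (qn i)]).
exists c; rewrite /coded_admissible /=.
have -> : (fun i => [ffun x => pi x] i) = pi.
  by apply: functional_extensionality => i; rewrite ffunE.
have -> : (fun l => nat_of_ord ([ffun l => Ordinal (glenn l)] l)) = glen.
  by apply: functional_extensionality => l; rewrite ffunE.
have -> : (fun i => nat_of_ord ([ffun i => Ordinal (qn i)] i)) = q.
  by apply: functional_extensionality => i; rewrite ffunE.
exact: adm.
Qed.

Lemma all_outputs : tested_outputs (fun env =>
  input1 env *m input2 env = input2 env *m input1 env /\
  exists c, coded_admissible c (input1 env) (input2 env)).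
Proof.
have hc (c : shape_code) : tested_outputs (fun env =>
    input1 env *m input2 env = input2 env *m input1 env /\
    coded_admissible c (input1 env) (input2 env)).
  by case: c => pg [[[[r rG] pi] glen] q]; apply: shape_outputs.
have ch c : {C : finType & {b : C -> Env -> bool & {X : C -> 'M[field_expr I]_n |
   [/\ forall d, testable (b d), forall d, correct_output (b d) (X d) &
       forall env, input1 env *m input2 env = input2 env *m input1 env /\
         coded_admissible c (input1 env) (input2 env) -> exists d, b d env]}}}.
  have [C HC] := constructive_indefinite_description _ (hc c).
  have [b Hb] := constructive_indefinite_description _ HC.
  by have [X HX] := constructive_indefinite_description _ Hb; exists C, b, X.
pose C c : finType := tag (ch c).
pose b c : C c -> Env -> bool := tag (tagged (ch c)).
pose X c : C c -> 'M[field_expr I]_n := sval (tagged (tagged (ch c))).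
have CP c : [/\ forall d, testable (b c d), forall d, correct_output (b c d) (X c d) &
       forall env, input1 env *m input2 env = input2 env *m input1 env /\
         coded_admissible c (input1 env) (input2 env) -> exists d, b c d env].
  exact: svalP (tagged (tagged (ch c))).
exists {c : shape_code & C c}, (fun d => b (tag d) (tagged d)), (fun d => X (tag d) (tagged d)).
split.
- by move=> [c d]; have [+ _ _] := CP c; apply.
- by move=> [c d]; have [_ + _] := CP c; apply.
- move=> env [SN [c cP]]; have [_ _ /(_ env (conj SN cP))[d dP]] := CP c.
  by exists (Tagged C d).
Qed.

Lemma normal_form_algorithm : exists algo : matrix_algorithm n,
  forall (V : vectType k) (A S N : 'End(V)) (e : n.-tuple V),
    jordan_decomposition A S N -> basis_of fullv e ->
    uniform_normal_form S N (run_algorithm algo (matrix_of e S) (matrix_of e N)).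
Proof.
have [C [b [X [tb cX bE]]]] := all_outputs.
have [t tP] := tree_search (const_mx FZero) X tb.
exists t => V A S N e jd be; rewrite /run_algorithm; set env := (env in feval env).
have Se : matrix_of e S = input1 env by apply/matrixP => i j; rewrite [RHS]mxE.
have Ne : matrix_of e N = input2 env by apply/matrixP => i j; rewrite [RHS]mxE.
have [|c bc ->] := tP env; last exact: (cX c V A S N e env jd be Se Ne bc).
apply: bE; rewrite -Se -Ne; split.
  by apply: matrix_of_comm => // v; have [_ /lfunP/(_ v)] := jd; rewrite !comp_lfunE.
have [p [g [pi [r [rG [glen [q]]]]]]] := admissible_exists jd be.
exact: admissible_coded.
Qed.

End Algorithm.

(** * The uniform normal form *)

Unset Implicit Arguments.

Theorem mainTheorem1 (k : fieldType) (char0 : [pchar k] =i pred0) :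
  (forall (V : vectType k) (A S N : 'End(V)), jordan_decomposition A S N ->
     (* (1), choice of the diagrams *)
     (exists G : generators V, young_bases S N G /\
        forall l : 'I_(ngroups G), stable S (gen_space l)) /\
     (* (1), for every choice of the diagrams *)
     (forall G : generators V, young_bases S N G ->
        [/\ forall l : 'I_(ngroups G),
              chain_space N l =
                (\sum_(i < len l) iter i (lfun_img N) (gen_space l))%VS /\
              directv (\sum_(i < len l) iter i (lfun_img N) (gen_space l)),
            (\sum_l chain_space N (G := G) l)%VS = fullv,
            directv (\sum_l chain_space N (G := G) l) &
            forall l : 'I_(ngroups G), (l < nker G)%N ->
              (S @: gen_space l)%VS = 0%VS]) /\
     (forall G : generators V, young_bases S N G ->
        (forall l : 'I_(ngroups G), stable S (gen_space l)) ->
        (* (1), with S-invariance *)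
        [/\ forall (l : 'I_(ngroups G)) (i : 'I_(len l)),
              stable S (iter i (lfun_img N) (gen_space l)),
            forall l : 'I_(ngroups G),
              stable S (chain_space N l) /\
              char_poly_on S (chain_space N l) =
                char_poly_on S (gen_space l) ^+ len l &
            char_poly_on S fullv =
              \prod_(l < ngroups G) char_poly_on S (gen_space l) ^+ len l] /\
        (* (2) *)
        (exists (H : generators V) (pi : 'I_(ngroups H) -> 'I_(ngroups G)),
           refines S N pi /\ companion_bases S H) /\
        (forall (H : generators V) (pi : 'I_(ngroups H) -> 'I_(ngroups G)),
           refines S N pi -> companion_bases S H ->
           [/\ forall i : 'I_(ngroups H), (i < nker H)%N ->
                 companion_on S i = 0,
               (* (3) *)
               forall i : 'I_(ngroups H),
                 [/\ stable A (chain_space N i),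
                     basis_of (chain_space N i) (chain_tuple N i) &
                     matrix_of (chain_tuple N i) A =
                       Dblock (len i) (companion_on S i)] &
               (* (4) *)
               basis_of fullv (all_chains N H) /\
               matrix_of (all_chains N H) A = normal_form S H]))) /\
  (* (5) *)
  (forall n : nat, exists algo : matrix_algorithm n,
     forall (V : vectType k) (A S N : 'End(V)) (e : n.-tuple V),
       jordan_decomposition A S N -> basis_of fullv e ->
       uniform_normal_form S N
         (run_algorithm algo (matrix_of e S) (matrix_of e N))).
Proof.
split; last by move=> n; exact: normal_form_algorithm char0 n.
move=> V A S N jd; have [_ _ ss _] := jd.
have SN v : S (N v) = N (S v).
  by have [_ /lfunP/(_ v)] := jd; rewrite !comp_lfunE.
split; first by have [G [yG sG _]] := young_bases_exist jd; exists G.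
split=> [G [jG _]|G [jG _] st].
  have bG := jordan_full ss jG; have fG := basis_free bG; split.
  - by move=> l; split; [exact: chain_spaceE | exact: chain_space_direct].
  - by rewrite -span_all_chains (span_basis bG).
  - exact: sum_chain_space_direct.
  - by move=> l lk; apply/eqP; rewrite -lkerE; apply: jordan_gen_ker jG lk.
split; [|split].
- have [cl cf] := chain_char_polys jd jG st; split=> // l i.
  exact: stable_iter_limg.
- have [|p [pi [r [q [v [P rd]]]]]] := refining_data_exists ss st; first by case: jG.
  by exists (krylov_generators S r (fun i => len (pi i)) q v), pi;
    apply: refining_data_refines rd.
- move=> H pi [jH _ _ _ [sH _]] cH; exact: refined_normal_form.
Qed.
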